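(* For every natural number $n$, with all sums over pairs $(a,b)\in\mathbb{N}_0^2$ satisfying $a+2b=n$, $$\delta_4(n)=\frac14\sum_{a+2b=n}r_2(a)\,r_2(8b+2),$$ $$\delta_6(n)=\frac18\sum_{a+2b=n}r_3(a)\,r_3(8b+3),$$ $$\delta_8(n)=\sum_{a+2b=n}r_4(a)\,\sigma(2b+1),$$ $$\delta_{12}(n)=-\frac18\sum_{a+2b=n}r_6(a)\,\sigma_{2;\mathbf{1},\chi_{-4}}(4b+3),$$ $$\delta_{16}(n)=\sum_{a+2b=n}r_8(a)\,\sigma_3^{\#}(b+1).$$
   Context: $\mathbb{N}_0=\{0,1,2,\dots\}$. $r_j(m)=\#\{\mathbf{y}\in\mathbb{Z}^j: m=\sum_{i=1}^j y_i^2\}$ and $\delta_j(m)=\#\{\mathbf{z}\in\mathbb{N}_0^j: m=\sum_{i=1}^j\frac{z_i(z_i+1)}{2}\}$. $\sigma(m)=\sum_{d\mid m}d$. $\sigma_3^{\#}(m)=\sum_{d\mid m,\ m/d\text{ odd}}d^3$. For primitive Dirichlet characters $\chi,\psi$, $\sigma_{k;\chi,\psi}(m)=\sum_{d\mid m}\psi(d)\chi(m/d)d^k$; $\mathbf{1}$ is the trivial character with $\mathbf{1}(m)=1$ for all $m\ge 1$, and $\chi_{-4}$ is the odd Dirichlet character modulo $4$. *)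

(* Defs.v *)
From mathcomp Require Import all_boot all_order all_algebra.
From mathcomp Require Import finmap boolp classical_sets functions cardinality.
From mathcomp Require Import zify.

Set Implicit Arguments.
Unset Strict Implicit.
Unset Printing Implicit Defensive.

Import Order.TTheory GRing.Theory Num.Theory.

Local Open Scope classical_set_scope.
Local Open Scope ring_scope.

Definition square_reps (j m : nat) : set {ffun 'I_j -> int} :=
  [set y : {ffun 'I_j -> int} | m%:Z = \sum_(i < j) y i ^+ 2].
Arguments square_reps : clear implicits.

(* [z * z.+1] is even, so [_./2] is the exact quotient. *)
Definition triangular_reps (j m : nat) : set {ffun 'I_j -> nat} :=
  [set z : {ffun 'I_j -> nat} | m = (\sum_(i < j) (z i * (z i).+1)./2)%N].
Arguments triangular_reps : clear implicits.

(* [fset_set] sends infinite sets to [fset0]; the two lemmas below show that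
   this default value is never used. *)
Definition r_ (j m : nat) : nat := #|` fset_set (square_reps j m)|%fset.
Definition delta_ (j m : nat) : nat := #|` fset_set (triangular_reps j m)|%fset.

Lemma finite_square_reps (j m : nat) : finite_set (square_reps j m).
Proof.
pose f (u : {ffun 'I_j -> 'I_(m + m).+1}) : {ffun 'I_j -> int} :=
  [ffun i => (u i)%:Z - m%:Z].
have fin : finite_set (f @` [set: {ffun 'I_j -> 'I_(m + m).+1}]).
  by apply: finite_image; apply: finite_finset.
apply: sub_finite_set fin => y /= my.
have le i : (absz (y i) <= m)%N.
  have : y i ^+ 2 <= m%:Z.
    by rewrite my (bigD1 i) //= lerDl sumr_ge0 // => k _; rewrite sqr_ge0.
  by rewrite expr2; move: (y i) => t; nia.
exists [ffun i => inord (absz (y i + m%:Z))] => //.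
apply/ffunP => i; rewrite !ffunE; move: (le i); move: (y i) => t let_m.
by rewrite inordK; lia.
Qed.

Lemma finite_triangular_reps (j m : nat) : finite_set (triangular_reps j m).
Proof.
pose f (u : {ffun 'I_j -> 'I_m.+1}) : {ffun 'I_j -> nat} :=
  [ffun i => nat_of_ord (u i)].
have fin : finite_set (f @` [set: {ffun 'I_j -> 'I_m.+1}]).
  by apply: finite_image; apply: finite_finset.
apply: sub_finite_set fin => z /= mz.
have le i : (z i <= m)%N.
  rewrite mz (bigD1 i) //=; apply: leq_trans (leq_addr _ _).
  by move: (z i) => t; rewrite -divn2 leq_divRL //; nia.
exists [ffun i => inord (z i)] => //.
by apply/ffunP => i; rewrite !ffunE inordK // ltnS.
Qed.

Definition sigma (m : nat) : nat := (\sum_(d <- divisors m) d)%N.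

Definition sigma3_sharp (m : nat) : nat :=
  (\sum_(d <- divisors m | odd (m %/ d)) d ^ 3)%N.

(* Characters are given as functions on [nat]; [divisors m] is used for m > 0
   only ([divisors 0] is empty). *)
Definition sigma_chi (R : pzRingType) (k : nat) (chi psi : nat -> R)
    (m : nat) : R :=
  \sum_(d <- divisors m) psi d * chi (m %/ d)%N * d%:R ^+ k.

Definition dirichlet_char (R : pzRingType) (N : nat) (chi : nat -> R) : Prop :=
  [/\ chi 1%N = 1, forall a b : nat, chi (a * b)%N = chi a * chi b,
      forall a : nat, chi (a + N)%N = chi a
    & forall a : nat, chi a != 0 <-> coprime a N].

Definition chi_one (R : pzRingType) (m : nat) : R := 1.

Definition chi_m4 (R : pzRingType) (m : nat) : R :=
  if (m %% 4 == 1)%N then 1 else if (m %% 4 == 3)%N then -1 else 0.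

Lemma chi_one_dirichlet (R : nzRingType) : dirichlet_char 1 (chi_one R).
Proof.
split=> // [a b|a]; first by rewrite /chi_one mulr1.
by rewrite /chi_one coprimen1 oner_neq0.
Qed.

Lemma chi_m4_dirichlet (R : nzRingType) : dirichlet_char 4 (chi_m4 R).
Proof.
split=> [|a b|a|a]; rewrite /chi_m4 //; last 2 first.
- by rewrite modnDr.
- rewrite -coprime_modl; have : (a %% 4 < 4)%N by rewrite ltn_mod.
  by case: (a %% 4)%N => [|[|[|[|c]]]] //= _; rewrite ?oppr_eq0 ?oner_eq0 ?eqxx.
rewrite -modnMm.
have : (a %% 4 < 4)%N by rewrite ltn_mod.
have : (b %% 4 < 4)%N by rewrite ltn_mod.
case: (a %% 4)%N => [|[|[|[|c]]]] //; case: (b %% 4)%N => [|[|[|[|d]]]] //=;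
  by rewrite ?mulr0 ?mul0r ?mulr1 ?mul1r ?mulrNN ?mulr1.
Qed.

(* Oddness, chi(-1) = -1, reads chi(3) = -1 modulo 4. *)
Lemma chi_m4_unique (R : nzRingType) (chi : nat -> R) :
  dirichlet_char 4 chi -> chi 3 = -1 -> chi =1 chi_m4 R.
Proof.
case=> chi1 _ chiD chi0 chi3 m.
have chiE q s : chi (q * 4 + s)%N = chi s.
  by elim: q => [//|q IH]; rewrite mulSn -addnA addnC chiD.
rewrite {1}(divn_eq m 4) chiE /chi_m4.
have : (m %% 4 < 4)%N by rewrite ltn_mod.
case: (m %% 4)%N => [|[|[|[|c]]]] //= _; apply/eqP.
  by case: eqP => // /eqP /chi0.
by case: eqP => // /eqP /chi0.
Qed.

(* Main.v *)
(* Let phi(q) be the sum of q^(k^2) over k in Z, psi(q) the sum of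
   q^(k(k+1)/2) over k >= 0. From psi(q)^2 = phi(q) psi(q^2) we get
   psi(q)^(2k) = phi(q)^k psi(q^2)^k, that is,
     delta_(2k)(n) = sum_(a+2b=n) r_k(a) delta_k(b),
   and it remains to evaluate delta_k(b) for k = 2, 3, 4, 6, 8.
   For k = 2, 3 compare coefficients in powers of
   phi(q) = phi(q^4) + 2 q psi(q^8). For k = 4, 6, 8 use two identities of
   Liouville type, valid for every even F, with chi = chi_(-4) and M odd:
     sum_(ax+by=2N; a,b,x,y odd) (F(a-b) - F(a+b))
       = sum_(dx=N; x odd) d (F(0) - F(2d)),
     2 sum_(ax+2ny=M; y odd) chi(x) chi(y) (F(a+2n) + F(a-2n))
       = sum_(dx=M) F(d) (d - chi(x)).
   Let P = 1 + 4 sum_n (sum_(d|n) chi(d)) q^n,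
   Q = sum_n (sum_(d|4n+1) chi(d)) q^n and S = sum_n sigma(2n+1) q^n. The first
   identity with F(t) = cos(pi t/2) gives Q^2 = S, and with F(t) = t^2 it
   evaluates S^2; the second one gives P(q) Q(q^2) = S for F = 1 and the odd
   part of P S for F(t) = t chi(t). The pairs (phi^2, psi^2) and (P, Q) both
   satisfy Q(q)^2 = P(q) Q(q^2) and P(q) = P(q^2) + 4 q Q(q^4), which determine
   them given their constant terms; so phi^2 = P, psi^2 = Q, psi^4 = S. *)

From HB Require Import structures.
Require Import Defs.
From mathcomp Require Import all_boot all_order all_algebra.
From mathcomp Require Import boolp classical_sets cardinality finmap.
From mathcomp Require Import zify ring.

Set Implicit Arguments.
Unset Strict Implicit.
Unset Printing Implicit Defensive.
Import Order.TTheory GRing.Theory Num.Theory.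
Local Open Scope ring_scope.

(** * Formal power series *)

(** A series is its coefficient function, so [funext] reduces equality of series to equality of
    coefficients. *)
Definition fps := nat -> int.
HB.instance Definition _ := gen_eqMixin fps.
HB.instance Definition _ := gen_choiceMixin fps.

Definition fps_mul (f g : fps) : fps := fun n => \sum_(i < n.+1) f i * g (n - i)%N.
Definition fps_trunc n (f : fps) : {poly int} := \poly_(i < n.+1) f i.

(** Coefficients of a product up to degree n involve only the truncations, so the ring laws can be
    pulled back from [{poly int}]. *)
Lemma fps_mulE (f g : fps) n m : (m <= n)%N ->
  fps_mul f g m = (fps_trunc n f * fps_trunc n g)`_m.
Proof.
move=> mn; rewrite coefM; apply: eq_bigr => -[i /= im] _.
by rewrite !coef_poly !ifT //; lia.
Qed.

Lemma fps_addA : associative (fun f g : fps => (fun n => f n + g n) : fps).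
Proof. by move=> f g h; apply: funext => n; rewrite addrA. Qed.
Lemma fps_addC : commutative (fun f g : fps => (fun n => f n + g n) : fps).
Proof. by move=> f g; apply: funext => n; rewrite addrC. Qed.
Lemma fps_add0 : left_id ((fun=> 0) : fps) (fun f g : fps => (fun n => f n + g n) : fps).
Proof. by move=> f; apply: funext => n; rewrite add0r. Qed.
Lemma fps_addN : left_inverse ((fun=> 0) : fps) (fun (f : fps) n => - f n)
  (fun f g : fps => (fun n => f n + g n) : fps).
Proof. by move=> f; apply: funext => n; rewrite addNr. Qed.
HB.instance Definition _ := GRing.isZmodule.Build fps fps_addA fps_addC fps_add0 fps_addN.

Lemma fps_mulC : commutative fps_mul.
Proof. by move=> f g; apply: funext => n; rewrite !(@fps_mulE _ _ n) // mulrC. Qed.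

Lemma fps_mul_trunc (f g h : fps) n :
  fps_mul (fps_mul f g) h n = (fps_trunc n f * fps_trunc n g * fps_trunc n h)`_n.
Proof.
rewrite coefM; apply: eq_bigr => -[i /= im] _.
by rewrite (@fps_mulE _ _ n) // coef_poly ifT //; lia.
Qed.

Lemma fps_mulA : associative fps_mul.
Proof.
move=> f g h; apply: funext => n.
by rewrite fps_mulC !fps_mul_trunc mulrC mulrA.
Qed.

Definition fps_one : fps := fun n => (n == 0)%N%:Z.
Lemma fps_mul1 : left_id fps_one fps_mul.
Proof.
move=> f; apply: funext => n; rewrite /fps_mul big_ord_recl /fps_one mul1r subn0.
by rewrite big1 ?addr0 // => i _; rewrite mul0r.
Qed.

Lemma fps_mulD : left_distributive fps_mul +%R.
Proof.
move=> f g h; apply: funext => n; rewrite /fps_mul -[RHS]big_split.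
by apply: eq_bigr => i _; rewrite mulrDl.
Qed.

Lemma fps_oner_neq0 : fps_one != 0.
Proof. by apply/eqP => /(congr1 (fun f => f 0%N)). Qed.

HB.instance Definition _ := GRing.Zmodule_isComNzRing.Build fps
  fps_mulA fps_mulC fps_mul1 fps_mulD fps_oner_neq0.

Lemma coef_fpsM (f g : fps) n : (f * g) n = \sum_(i < n.+1) f i * g (n - i)%N.
Proof. by []. Qed.
Lemma coef_fpsD (f g : fps) n : (f + g) n = f n + g n.
Proof. by []. Qed.
Lemma coef_fpsB (f g : fps) n : (f - g) n = f n - g n.
Proof. by []. Qed.
Lemma coef_fpsN (f : fps) n : (- f) n = - f n.
Proof. by []. Qed.
Lemma coef_fpsMn (f : fps) k n : (f *+ k) n = f n *+ k.
Proof. by elim: k => [//|k IH]; rewrite !mulrS coef_fpsD IH. Qed.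
Lemma coef_fps1 n : (1 : fps) n = (n == 0)%N%:Z.
Proof. by []. Qed.

Lemma coef_fps_sum (I : Type) (r : seq I) (P : pred I) (F : I -> fps) n :
  (\sum_(i <- r | P i) F i) n = \sum_(i <- r | P i) F i n.
Proof. by elim/big_rec2: _ => [//|i y1 y2 Pi <-]. Qed.

(** * Monomials, congruence modulo a power of q, counting by coefficients *)

Definition mono m : fps := fun n => (n == m)%N%:Z.

Lemma coef_monoM m (f : fps) n : (mono m * f) n = if (m <= n)%N then f (n - m)%N else 0.
Proof.
rewrite coef_fpsM; case: leqP => mn.
  have mn1 : (m < n.+1)%N by [].
  rewrite (bigD1 (Ordinal mn1)) //= big1 ?addr0 => [|i ne]; first by rewrite /mono eqxx mul1r.
  rewrite /mono (_ : (nat_of_ord i == m) = false) ?mul0r //.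
  by apply: contraNF ne => /eqP im; apply/eqP/val_inj.
apply: big1 => i _; rewrite /mono (_ : (nat_of_ord i == m) = false) ?mul0r //.
by have := ltn_ord i; lia.
Qed.

Lemma monoM m n : mono m * mono n = mono (m + n).
Proof.
apply: funext => k; rewrite coef_monoM /mono; case: leqP => mk.
  by congr (_%:Z); congr nat_of_bool; lia.
by rewrite (_ : (k == m + n)%N = false) //; lia.
Qed.

(** Congruence modulo q^(M+1): it lets a series be replaced by a finite sum of monomials. *)
Definition eqm M (f g : fps) := forall u, (u <= M)%N -> f u = g u.

Lemma eqmM M f f' g g' : eqm M f f' -> eqm M g g' -> eqm M (f * g) (f' * g').
Proof.
move=> ff gg u uM; rewrite !coef_fpsM; apply: eq_bigr => -[i /= iu] _.
by rewrite ff ?gg //; lia.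
Qed.

Lemma eqmX M f g j : eqm M f g -> eqm M (f ^+ j) (g ^+ j).
Proof. by move=> fg; elim: j => [//|j IH]; rewrite !exprS; apply: eqmM. Qed.

(** By distributivity the j-th power is a sum of monomials indexed by the maps f from 'I_j to I,
    with the total weight of f as exponent. *)
Lemma coef_fpsX_card (I : finType) (w : I -> nat) M (F : fps) j u :
  eqm M F (\sum_k mono (w k)) -> (u <= M)%N ->
  (F ^+ j) u = #|[pred f : {ffun 'I_j -> I} | u == \sum_i w (f i)]%N|%:Z.
Proof.
move=> FE uM; rewrite (eqmX j FE) //.
rewrite -[j in _ ^+ j]card_ord -prodr_const bigA_distr_bigA /= coef_fps_sum.
have monoS (r : seq 'I_j) (f : {ffun 'I_j -> I}) :
    \prod_(i <- r) mono (w (f i)) = mono (\sum_(i <- r) w (f i)).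
  by elim: r => [|i r IH]; rewrite ?big_nil // !big_cons IH monoM.
under eq_bigr do rewrite monoS.
rewrite -sum1_card (big_morph Posz PoszD (erefl _)) [RHS]big_mkcond.
by apply: eq_bigr => f _; rewrite /mono inE; case: eqP.
Qed.

(** * The substitution q -> q^2 *)

Definition dil (f : fps) : fps := fun n => if odd n then 0 else f n./2.
Local Notation X := (mono 1).

Lemma coef_dil2 f n : dil f (2 * n)%N = f n.
Proof. by rewrite /dil ifF; [congr f|]; lia. Qed.
Lemma coef_dil2S f n : dil f (2 * n).+1 = 0.
Proof. by rewrite /dil ifT //; lia. Qed.
Lemma coef_XM f n : (X * f) n.+1 = f n.
Proof. by rewrite coef_monoM subn1. Qed.
Lemma coef_XM0 f : (X * f) 0%N = 0.
Proof. by rewrite coef_monoM. Qed.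

Lemma sum_parity (V : zmodType) (F : nat -> V) m :
  \sum_(0 <= i < (2 * m).+1) F i =
  \sum_(0 <= j < m.+1) F (2 * j)%N + \sum_(0 <= j < m) F (2 * j).+1.
Proof.
elim: m => [|m IH]; first by rewrite !big_nat1 big_geq ?addr0.
rewrite mulnS big_nat_recr //= big_nat_recr //= IH [in RHS]big_nat_recr //=.
rewrite [X in _ = _ + X]big_nat_recr //= -!addrA; congr (_ + _).
by rewrite [RHS]addrCA; congr (_ + _); rewrite addrC; congr (F _ + F _); lia.
Qed.

Lemma dil_is_additive : zmod_morphism dil.
Proof.
move=> f g; apply: funext => n; rewrite coef_fpsB /dil.
by case: ifP => _; rewrite ?subr0 ?coef_fpsB.
Qed.

Lemma dil_is_multiplicative : monoid_morphism dil.
Proof.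
split=> [|f g]; apply: funext => n.
  by rewrite /dil !coef_fps1; case: ifP => o; [case: n o|congr (nat_of_bool _)%:Z; lia].
case: (boolP (odd n)) => on.
  rewrite /dil on coef_fpsM big1 // => -[i /= ilt] _.
  by case: ifP => oi; rewrite ?mul0r // ifT ?mulr0 //; lia.
have [m ->] : exists m, n = (2 * m)%N by exists n./2; lia.
rewrite coef_dil2 !coef_fpsM -(big_mkord xpredT (fun i => f i * g (m - i)%N)).
rewrite -(big_mkord xpredT (fun i => dil f i * dil g (2 * m - i)%N)) sum_parity.
rewrite [X in _ = _ + X]big1 ?addr0 => [|i _]; last by rewrite coef_dil2S mul0r.
by apply: eq_bigr => i _; rewrite -mulnBr !coef_dil2.
Qed.

HB.instance Definition _ := GRing.isZmodMorphism.Build fps fps dil dil_is_additive.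
HB.instance Definition _ := GRing.isMonoidMorphism.Build fps fps dil dil_is_multiplicative.

Lemma dil_mono m : dil (mono m) = mono (2 * m).
Proof.
apply: funext => n; rewrite /dil /mono; case: ifP => o.
  by rewrite (_ : (n == 2 * m)%N = false) //; lia.
by congr (nat_of_bool _)%:Z; lia.
Qed.

Lemma coef_fpsMz (f : fps) (c : int) n : (f *~ c) n = f n * c.
Proof.
case: c => k; first by rewrite -pmulrn coef_fpsMn -mulr_natr natz.
by rewrite NegzE mulrNz coef_fpsN -pmulrn coef_fpsMn mulrN -mulr_natr natz.
Qed.

(** Up to degree M both factors are finite combinations of monomials, and the pairs of total weight
    M make up the coefficient. *)
Lemma coefM_weighted (I J : eqType) (r : seq I) (s : seq J) (w : I -> nat) (v : J -> nat)
    (c : I -> int) (c' : J -> int) (f g : fps) M :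
  (forall u, (u <= M)%N -> f u = \sum_(i <- r | w i == u) c i) ->
  (forall u, (u <= M)%N -> g u = \sum_(j <- s | v j == u) c' j) ->
  (f * g) M = \sum_(t <- [seq (i, j) | i <- r, j <- s] | (w t.1 + v t.2 == M)%N) c t.1 * c' t.2.
Proof.
move=> fE gE.
have eqf (K : Type) (q : seq K) (z : K -> nat) (e : K -> int) (h : fps) :
    (forall u, (u <= M)%N -> h u = \sum_(i <- q | z i == u) e i) ->
    eqm M h (\sum_(i <- q) mono (z i) *~ e i).
  move=> hE u uM; rewrite hE // coef_fps_sum big_mkcond; apply: eq_bigr => i _.
  by rewrite coef_fpsMz /mono eq_sym; case: eqP; rewrite ?mul1r ?mul0r.
rewrite (eqmM (eqf _ _ _ _ _ fE) (eqf _ _ _ _ _ gE)) // [RHS]big_mkcond big_allpairs.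
rewrite mulr_suml coef_fps_sum; apply: eq_bigr => i _.
rewrite mulr_sumr coef_fps_sum; apply: eq_bigr => j _.
rewrite mulrzAl mulrzAr monoM !coef_fpsMz /mono /= eq_sym.
by case: eqP; rewrite ?mul1r ?mul0r // mulrC.
Qed.

(** * Two identities of Liouville type *)

(** The maps have to be mutually inverse only where the predicates hold, so both may use truncated
    subtraction and integer division. *)
Lemma sum_bij (V : zmodType) (I J : eqType) (r : seq I) (s : seq J)
    (P : pred I) (Q : pred J) (F : I -> V) (G : J -> V) (h : I -> J) (k : J -> I) :
  uniq r -> uniq s ->
  (forall i, i \in r -> P i -> [/\ h i \in s, Q (h i), k (h i) = i & F i = G (h i)]) ->
  (forall j, j \in s -> Q j -> [/\ k j \in r, P (k j) & h (k j) = j]) ->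
  \sum_(i <- r | P i) F i = \sum_(j <- s | Q j) G j.
Proof.
move=> ur us hP kQ; rewrite -big_filter -[RHS]big_filter.
have eq_hr : perm_eq [seq j <- s | Q j] [seq h i | i <- [seq i <- r | P i]].
  apply: uniq_perm; rewrite ?filter_uniq ?map_inj_in_uniq ?filter_uniq //.
    move=> i j; rewrite !mem_filter => /andP[Pi ri] /andP[Pj rj] e.
    by have [_ _ <- _] := hP _ ri Pi; have [_ _ <- _] := hP _ rj Pj; rewrite e.
  move=> j; rewrite mem_filter; apply/andP/mapP => [[Qj sj]|[i]].
    have [rk Pk hk] := kQ _ sj Qj.
    by exists (k j); rewrite ?mem_filter ?Pk.
  by rewrite mem_filter => /andP[Pi ri] ->; have [] := hP _ ri Pi.
rewrite (perm_big _ eq_hr) big_map big_seq [RHS]big_seq; apply: eq_bigr => i.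
by rewrite mem_filter => /andP[Pi ri]; have [] := hP _ ri Pi.
Qed.

(** * Finite boxes of candidate solutions *)

Section Boxes.
Variable B : nat.
(* A quadruple ((a, x), (b, y)) stands for a solution of a x + b y = M. *)
Definition posbox2 := [seq (d, e) | d <- iota 1 B, e <- iota 1 B].
Definition posbox4 := [seq (p, q) | p <- posbox2, q <- posbox2].
(** The extra coordinate enumerates an inner sum attached to each pair, for instance a
    multiplicity. *)
Definition posbox3 := [seq (p, k) | p <- posbox2, k <- iota 0 B].

Lemma uniq_posbox2 : uniq posbox2.
Proof. by apply: allpairs_uniq; rewrite ?iota_uniq //; case=> [? ?] [? ?]. Qed.
Lemma uniq_posbox3 : uniq posbox3.
Proof. by apply: allpairs_uniq; rewrite ?uniq_posbox2 ?iota_uniq //; case=> [? ?] [? ?]. Qed.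
Lemma uniq_posbox4 : uniq posbox4.
Proof. by apply: allpairs_uniq; rewrite ?uniq_posbox2 //; case=> [? ?] [? ?]. Qed.

End Boxes.

Lemma mem_pairs (S T : eqType) (s : seq S) (t : seq T) x y :
  ((x, y) \in [seq (p, q) | p <- s, q <- t]) = (x \in s) && (y \in t).
Proof.
by apply/allpairsP/andP => [[[p q] [? ? [-> ->]]]|[? ?]]; last exists (x, y).
Qed.
Arguments sum_bij {V I J r s P Q F G} h k.

Definition odd_sol M (t : (nat * nat) * (nat * nat)) :=
  [&& odd t.1.1, odd t.1.2, odd t.2.1, odd t.2.2 & t.1.1 * t.1.2 + t.2.1 * t.2.2 == M]%N.

(** The parities that odd a, x, b, y produce under (a - b, x, b, x + y) and under (a + b, x, b, y -
    x). *)
Definition even_sol M (t : (nat * nat) * (nat * nat)) :=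
  [&& ~~ odd t.1.1, odd t.1.2, odd t.2.1, ~~ odd t.2.2 & t.1.1 * t.1.2 + t.2.1 * t.2.2 == M]%N.

Lemma posbox4_gt0 M a x b y : ((a, x), (b, y)) \in posbox4 M ->
  [&& 0 < a, 0 < x, 0 < b & 0 < y]%N.
Proof. by rewrite !mem_pairs !mem_iota; lia. Qed.

Lemma mem_posbox4 M a x b y : (a * x + b * y = M)%N ->
  [&& 0 < a, 0 < x, 0 < b & 0 < y]%N -> ((a, x), (b, y)) \in posbox4 M.
Proof.
move=> e /and4P[a0 x0 b0 y0]; rewrite !mem_pairs !mem_iota !add1n !ltnS.
by apply/andP; split; apply/andP; split; apply/andP; split=> //; nia.
Qed.

Lemma eq_quad (T1 T2 T3 T4 : Type) (a a' : T1) (x x' : T2) (b b' : T3) (y y' : T4) :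
  a = a' -> x = x' -> b = b' -> y = y' -> ((a, x), (b, y)) = ((a', x'), (b', y')).
Proof. by move=> -> -> -> ->. Qed.


(** * The first identity of Liouville type *)

Section Liouville1.
Variables (M : nat) (F : nat -> int).
Local Notation box := (posbox4 M).

(* (a - b) x + b (x + y) = a x + b y = (a + b) x + b (y - x). *)
Lemma sum_diff_gt :
  \sum_(t <- box | odd_sol M t && (t.2.1 < t.1.1)%N) F (t.1.1 - t.2.1)%N =
  \sum_(t <- box | even_sol M t && (t.1.2 < t.2.2)%N) F t.1.1.
Proof.
apply: (sum_bij
  (fun t => ((t.1.1 - t.2.1, t.1.2), (t.2.1, t.1.2 + t.2.2)))%N
  (fun t => ((t.1.1 + t.2.1, t.1.2), (t.2.1, t.2.2 - t.1.2)))%N);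
  rewrite ?uniq_posbox4 //.
- move=> [[a x] [b y]] /posbox4_gt0 bnd.
  rewrite /odd_sol /even_sol /= => /andP[/and5P[oa ox ob oy /eqP e] lt].
  have e' : ((a - b) * x + b * (x + y) = M)%N by nia.
  by split; [apply: mem_posbox4 => //; lia|lia|apply: eq_quad; lia|].
- move=> [[a x] [b y]] /posbox4_gt0 bnd.
  rewrite /odd_sol /even_sol /= => /andP[/and5P[oa ox ob oy /eqP e] lt].
  have e' : ((a + b) * x + b * (y - x) = M)%N by nia.
  by split; [apply: mem_posbox4 => //; lia|lia|apply: eq_quad; lia].
Qed.

Lemma sum_add_lt :
  \sum_(t <- box | odd_sol M t && (t.1.2 < t.2.2)%N) F (t.1.1 + t.2.1)%N =
  \sum_(t <- box | even_sol M t && (t.2.1 < t.1.1)%N) F t.1.1.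
Proof.
apply: (sum_bij
  (fun t => ((t.1.1 + t.2.1, t.1.2), (t.2.1, t.2.2 - t.1.2)))%N
  (fun t => ((t.1.1 - t.2.1, t.1.2), (t.2.1, t.2.2 + t.1.2)))%N);
  rewrite ?uniq_posbox4 //.
- move=> [[a x] [b y]] /posbox4_gt0 bnd.
  rewrite /odd_sol /even_sol /= => /andP[/and5P[oa ox ob oy /eqP e] lt].
  have e' : ((a + b) * x + b * (y - x) = M)%N by nia.
  by split; [apply: mem_posbox4 => //; lia|lia|apply: eq_quad; lia|].
- move=> [[a x] [b y]] /posbox4_gt0 bnd.
  rewrite /odd_sol /even_sol /= => /andP[/and5P[oa ox ob oy /eqP e] lt].
  have e' : ((a - b) * x + b * (y + x) = M)%N by nia.
  by split; [apply: mem_posbox4 => //; lia|lia|apply: eq_quad; lia].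
Qed.

(** Dividing an odd number by an even one leaves an odd, hence nonzero, remainder; so the exchange
    below stays among positive solutions of the same parities. *)
Lemma odd_div_rest b A x Y : odd b -> ~~ odd A -> ~~ odd Y -> (0 < A)%N ->
  [/\ odd (b %% A), (0 < b %% A < A)%N & odd (x + b %/ A * Y) = odd x].
Proof.
move=> ob oA oY A0; have := divn_eq b A; have := ltn_pmod b A0 => lt e.
have o : odd (b %% A) by move: ob; rewrite {1}e oddD oddM (negbTE oA) andbF.
by split; [|lia|rewrite oddD oddM (negbTE oY) andbF addbF].
Qed.

(* Division with remainder of b by A trades b >= A for x >= Y. *)
Lemma sum_even_exchange :
  \sum_(t <- box | even_sol M t && (t.1.2 < t.2.2)%N) F t.1.1 =
  \sum_(t <- box | even_sol M t && (t.2.1 < t.1.1)%N) F t.1.1.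
Proof.
apply: (sum_bij
  (fun t => ((t.1.1, t.1.2 + t.2.1 %/ t.1.1 * t.2.2), (t.2.1 %% t.1.1, t.2.2)))%N
  (fun t => ((t.1.1, t.1.2 %% t.2.2), (t.2.1 + t.1.2 %/ t.2.2 * t.1.1, t.2.2)))%N);
  rewrite ?uniq_posbox4 //.
- move=> [[a x] [b y]] /posbox4_gt0 bnd.
  rewrite /even_sol /= => /andP[/and5P[oa ox ob oy /eqP e] lt].
  have a0 : (0 < a)%N by lia.
  have [o1 b1 o2] := odd_div_rest x ob oa oy a0.
  have e' : (a * (x + b %/ a * y) + b %% a * y = M)%N.
    by rewrite -e {3}(divn_eq b a); ring.
  have q0 : (0 < x + b %/ a * y)%N by rewrite ltn_addr //; lia.
  split=> //; first by apply: mem_posbox4; rewrite ?e' // q0; lia.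
    by rewrite oa o2 ox o1 oy; lia.
  (* Since x < y, dividing x + (b %/ a) y by y gives back the quotient b %/ a and the remainder
     x. *)
  rewrite [(x + _)%N]addnC divnMDl; last lia.
  rewrite modnMDl (modn_small lt) (divn_small lt) addn0.
  by rewrite addnC -divn_eq.
- move=> [[a x] [b y]] /posbox4_gt0 bnd.
  rewrite /even_sol /= => /andP[/and5P[oa ox ob oy /eqP e] lt].
  have y0 : (0 < y)%N by lia.
  have [o1 b1 o2] := odd_div_rest b ox oy oa y0.
  have e' : (a * (x %% y) + (b + x %/ y * a) * y = M)%N.
    by rewrite -e {3}(divn_eq x y); ring.
  have q0 : (0 < b + x %/ y * a)%N by rewrite ltn_addr //; lia.
  split=> //; first by apply: mem_posbox4; rewrite ?e' // q0; lia.
    by rewrite oa o2 ob o1 oy; lia.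
  rewrite [(b + _)%N]addnC divnMDl; last lia.
  rewrite modnMDl (modn_small lt) (divn_small lt) addn0.
  by rewrite addnC -divn_eq.
Qed.

Let swap (T : Type) (t : T * T) := (t.2, t.1).

(** The equation and its parity conditions are symmetric in the pairs (a, x) and (b, y). *)
Lemma sum_swap (G : nat -> int) (R S : rel nat) (g : nat -> nat -> nat) :
  (forall a b, g a b = g b a) ->
  \sum_(t <- box | odd_sol M t && (R t.1.1 t.2.1 && S t.1.2 t.2.2)) G (g t.1.1 t.2.1) =
  \sum_(t <- box | odd_sol M t && (R t.2.1 t.1.1 && S t.2.2 t.1.2)) G (g t.1.1 t.2.1).
Proof.
move=> gC; apply: (sum_bij (@swap _) (@swap _)); rewrite ?uniq_posbox4 //.
- move=> [[a x] [b y]] /posbox4_gt0 bnd.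
  rewrite /odd_sol /swap /= => /andP[/and5P[oa ox ob oy /eqP e] lt].
  by split; [apply: mem_posbox4; lia|rewrite lt oa ox ob oy; lia| |rewrite gC].
- move=> [[a x] [b y]] /posbox4_gt0 bnd.
  rewrite /odd_sol /swap /= => /andP[/and5P[oa ox ob oy /eqP e] lt].
  by split; [apply: mem_posbox4; lia|rewrite lt oa ox ob oy; lia|].
Qed.


(** Exchanging a with x and b with y brings the diagonal x = y to the form evaluated by
    [sum_diag]. *)
Lemma sum_transpose :
  \sum_(t <- box | odd_sol M t && (t.1.2 == t.2.2)%N) F (t.1.1 + t.2.1)%N =
  \sum_(t <- box | odd_sol M t && (t.1.1 == t.2.1)%N) F (t.1.2 + t.2.2)%N.
Proof.
pose tr (t : (nat * nat) * (nat * nat)) := (swap t.1, swap t.2).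
apply: (sum_bij tr tr); rewrite ?uniq_posbox4 //.
- move=> [[a x] [b y]] /posbox4_gt0 bnd.
  rewrite /odd_sol /tr /swap /= => /andP[/and5P[oa ox ob oy /eqP e] lt].
  by split; [apply: mem_posbox4; lia|rewrite lt oa ox ob oy; lia| |].
- move=> [[a x] [b y]] /posbox4_gt0 bnd.
  rewrite /odd_sol /tr /swap /= => /andP[/and5P[oa ox ob oy /eqP e] lt].
  by split; [apply: mem_posbox4; lia|rewrite lt oa ox ob oy; lia|].
Qed.

End Liouville1.

(** Flattens a double sum into a sum over one list, so that [sum_bij] applies to it. *)
Lemma sum_posbox3 (V : zmodType) B (P : pred (nat * nat)) (G : nat * nat -> nat -> V)
    (c : nat * nat -> nat) :
  (forall p, p \in posbox2 B -> P p -> (c p <= B)%N) ->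
  \sum_(q <- posbox3 B | P q.1 && (q.2 < c q.1)%N) G q.1 q.2 =
  \sum_(p <- posbox2 B | P p) \sum_(0 <= k < c p) G p k.
Proof.
move=> cB; rewrite big_mkcond big_allpairs [RHS]big_mkcond big_seq [RHS]big_seq.
apply: eq_bigr => p pB /=; case: (boolP (P p)) => [Pp|_] /=; last by rewrite big1.
by rewrite (big_nat_widen _ _ B) ?cB // -big_mkcond /index_iota !subn0.
Qed.

(** If a = b then a (x + y) = 2 N, so x + y = 2 d with d a = N, and the odd x between 0 and 2 d are
    the d numbers 2 k + 1 with k < d. *)
Lemma sum_diag N (G : nat -> int) :
  \sum_(t <- posbox4 (2 * N) | odd_sol (2 * N) t && (t.1.1 == t.2.1)%N) G (t.1.2 + t.2.2)%N =
  \sum_(p <- posbox2 (2 * N) | (p.1 * p.2 == N)%N && odd p.2) G (2 * p.1)%N *+ p.1.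
Proof.
under [RHS]eq_bigr => p _ do rewrite -[p.1]subn0 -sumr_const_nat subn0.
rewrite -sum_posbox3; last by move=> [d e]; rewrite mem_pairs !mem_iota /=; lia.
apply: (sum_bij (fun t => (((t.1.2 + t.2.2)./2, t.1.1), t.1.2./2))
  (fun q => ((q.1.2, q.2.*2.+1), (q.1.2, 2 * q.1.1 - q.2.*2.+1)))%N).
- exact: uniq_posbox4.
- by apply: allpairs_uniq; rewrite ?uniq_posbox2 ?iota_uniq //; case=> [? ?] [? ?].
- move=> [[a x] [b y]] /posbox4_gt0 bnd.
  rewrite /odd_sol /= => /andP[/and5P[oa ox ob oy /eqP e] /eqP ab].
  subst b.
  have h2 : (2 * (x + y)./2 = x + y)%N by lia.
  have e' : ((x + y)./2 * a = N)%N by move: e; rewrite -mulnDr; move: h2; set h := _./2 => <-; nia.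
  have b1 : ((x + y)./2 <= N)%N by rewrite -e' leq_pmulr //; lia.
  have b2 : (a <= N)%N by rewrite -e' leq_pmull //; lia.
  split; first by rewrite !mem_pairs !mem_iota /=; lia.
  + by rewrite e' eqxx oa; lia.
  + by apply: eq_quad; lia.
  + by congr G; lia.
- move=> [[d e] k]; rewrite !mem_pairs !mem_iota /= => bnd /andP[/andP[/eqP de oe] kd].
  have e' : (e * (k.*2.+1) + e * (2 * d - k.*2.+1) = 2 * N)%N by rewrite -mulnDr subnKC; [nia|lia].
  have dN : (d <= N)%N by rewrite -de leq_pmulr; lia.
  have eN : (e <= N)%N by rewrite -de leq_pmull; lia.
  split; first lia.
  + by rewrite /odd_sol /= e' oe !eqxx andbT; lia.
  + by congr (_, _, _); lia.
Qed.

(* [(a - b) + (b - a)] is |a - b|, the subtractions being truncated. *)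
Lemma liouville_even N (F : nat -> int) :
  \sum_(t <- posbox4 (2 * N) | odd_sol (2 * N) t)
     (F ((t.1.1 - t.2.1) + (t.2.1 - t.1.1))%N - F (t.1.1 + t.2.1)%N) =
  \sum_(p <- posbox2 (2 * N) | (p.1 * p.2 == N)%N && odd p.2) (F 0%N - F (2 * p.1)%N) *+ p.1.
Proof.
pose M := (2 * N)%N; set dist := fun a b => ((a - b) + (b - a))%N.
have split3 (c : (nat * nat) * (nat * nat) -> nat * nat) (G : (nat * nat) * (nat * nat) -> int) :
    \sum_(t <- posbox4 M | odd_sol M t) G t =
    \sum_(t <- posbox4 M | odd_sol M t && ((c t).1 == (c t).2)%N) G t +
    (\sum_(t <- posbox4 M | odd_sol M t && ((c t).1 < (c t).2)%N) G t +
     \sum_(t <- posbox4 M | odd_sol M t && ((c t).2 < (c t).1)%N) G t).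
  rewrite (bigID (fun t => (c t).1 == (c t).2)%N) /=; congr (_ + _).
  rewrite (bigID (fun t => (c t).1 < (c t).2)%N) /=; congr (_ + _);
  by apply: eq_bigl => t; rewrite -andbA; congr (_ && _); lia.
(* The sum of F(|a - b|) is split by comparing a with b, that of F(a + b) by comparing x with y. By
   [sum_swap] the two strict parts of each are equal. *)
rewrite sumrB (split3 (fun t => (t.1.1, t.2.1))) (split3 (fun t => (t.1.2, t.2.2))) /=.
have distC a b : dist a b = dist b a by rewrite /dist addnC.
have -> : \sum_(t <- posbox4 M | odd_sol M t && (t.1.1 < t.2.1)%N)
    F (dist t.1.1 t.2.1) = \sum_(t <- posbox4 M | odd_sol M t && (t.2.1 < t.1.1)%N)
    F (dist t.1.1 t.2.1).
  have := @sum_swap M F (fun a b => (a < b)%N) (fun _ _ => true) dist distC.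
  by rewrite /= => h; etransitivity; [|etransitivity; [exact: h|]];
    apply: eq_bigl => t; rewrite andbT.
have := @sum_swap M F (fun _ _ => true) (fun a b => (a < b)%N) addn addnC.
rewrite /= => <-.
have -> : \sum_(t <- posbox4 M | odd_sol M t && (t.2.1 < t.1.1)%N)
    F (dist t.1.1 t.2.1) = \sum_(t <- posbox4 M | odd_sol M t && (t.2.1 < t.1.1)%N)
    F (t.1.1 - t.2.1)%N.
  by apply: eq_bigr => t /andP[_ lt]; congr F; rewrite /dist; lia.
(* Both strict parts become the same sum over even solutions and cancel; only the two diagonals
   survive. *)
rewrite sum_diff_gt sum_add_lt sum_even_exchange sum_transpose.
have -> : \sum_(t <- posbox4 M | odd_sol M t && (t.1.1 == t.2.1)%N)
    F (dist t.1.1 t.2.1) = \sum_(t <- posbox4 M | odd_sol M t && (t.1.1 == t.2.1)%N) F 0%N.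
  by apply: eq_bigr => t /andP[_ lt]; congr F; rewrite /dist; lia.
rewrite /M (sum_diag N (fun=> F 0%N)) (sum_diag N F) opprD addrACA subrr addr0 -sumrB.
by apply: eq_bigr => p _; rewrite mulrnBl.
Qed.

(** * The character modulo 4 *)

Local Notation chi := (chi_m4 int).

Lemma chi_odd n : odd n -> chi n = (-1) ^+ n./2.
Proof.
move=> on; rewrite /chi_m4 -signr_odd.
have -> : (n %% 4 == 1)%N = ~~ odd n./2 by lia.
have -> : (n %% 4 == 3)%N = odd n./2 by lia.
by case: (odd n./2).
Qed.

Lemma chi_even n : ~~ odd n -> chi n = 0.
Proof. by move=> en; rewrite /chi_m4 !ifF //; lia. Qed.

Lemma eq_sign m n : odd m = odd n -> (-1) ^+ m = (-1) ^+ n :> int.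
Proof. by move=> e; rewrite -signr_odd e signr_odd. Qed.

Lemma ler_posM (u v : int) : 0 < u -> 0 < v -> (u <= u * v) && (v <= u * v).
Proof. by move=> u0 v0; rewrite ler_peMr ?ler_peMl; lia. Qed.

(** * The second identity of Liouville type *)

Section Liouville2.
Variables (M : nat) (F : nat -> int).
Hypothesis oM : odd M.
Local Notation box := (posbox4 M).

Definition mixed_sol (t : (nat * nat) * (nat * nat)) :=
  odd t.2.2 && (t.1.1 * t.1.2 + 2 * t.2.1 * t.2.2 == M)%N.

(* After A = |a -+ 2 n| and 2 z = |x +- y|, the unknowns x and n of
   A x + 4 n z = M become integers of either sign. *)
Definition zrange := [seq i%:Z - M%:Z | i <- iota 0 (2 * M).+1].
Definition zbox : seq ((nat * int) * (int * nat)) :=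
  [seq (p, q) | p <- [seq (A, x) | A <- iota 1 M, x <- zrange],
                q <- [seq (n, z) | n <- zrange, z <- iota 1 M]].

Lemma mem_zrange (x : int) : (x \in zrange) = (`|x| <= M%:Z).
Proof.
apply/mapP/idP => [[i]|b]; first by rewrite mem_iota => ? ->; lia.
by exists (absz (x + M%:Z)); rewrite ?mem_iota; lia.
Qed.

Lemma uniq_zbox : uniq zbox.
Proof.
have uz : uniq zrange by rewrite map_inj_uniq ?iota_uniq // => i j h; lia.
by do !apply: allpairs_uniq; rewrite ?iota_uniq ?uz //; case=> ? ? [? ?].
Qed.

Definition zsol (t : (nat * int) * (int * nat)) :=
  let: ((A, x), (n, z)) := t in
  [&& odd A, (x %% 2 == 1)%Z, (0 < z)%N & A%:Z * x + 4 * n * z%:Z == M%:Z].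

(** [left_sol] is the image of the solutions with x <> y under A = a + 2 n, 2 z = |x - y|;
    [right_sol] is the image of all solutions under A = |a - 2 n|, 2 z = x + y. The implications say
    that the recovered y, resp. a, is positive. *)
Definition left_sol t := let: ((A, x), (n, z)) := t in
  [&& zsol t, 0 < x, n != 0, `|2 * n| < A%:Z & (n < 0) ==> (2 * z%:Z < x)].
Definition right_sol t := let: ((A, x), (n, z)) := t in
  [&& zsol t, 0 < n, `|x| < 2 * z%:Z & (x < 0) ==> (A%:Z < 2 * n)].
(** As A and x are odd, no boundary case occurs: [far_n] is [right_sol] without [left_sol], and
    [far_x] is [left_sol] without [right_sol] together with the terms n = 0. *)
Definition far_x t := let: ((A, x), (n, z)) := t in
  [&& zsol t, 2 * z%:Z < x & `|2 * n| < A%:Z].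
Definition far_n t := let: ((A, x), (n, z)) := t in
  [&& zsol t, `|x| < 2 * z%:Z & A%:Z < 2 * n].

(** When the two products have opposite signs, M still bounds them: 0 < u < A and 0 < v < x give A x
    - u v >= A x - (A - 1)(x - 1) = A + x - 1. *)
Lemma zsol_box t : zsol t -> left_sol t || far_x t || right_sol t || far_n t -> t \in zbox.
Proof.
case: t => [[A x] [n z]]; rewrite /left_sol /far_x /right_sol /far_n => zs.
rewrite zs /=; case/and4P: zs => oA ox z0 /eqP e c.
have cases : [|| [&& 0 < x, 0 <= n & (n == 0) ==> (2 * z%:Z < x)],
    [&& n < 0, 2 * z%:Z < x & - (2 * n) < A%:Z] |
    [&& x < 0, - x < 2 * z%:Z & A%:Z < 2 * n]] by lia.
have A0 : (0 < A)%N by lia.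
suff : [&& (A <= M)%N, `|x| <= M%:Z, `|n| <= M%:Z & (z <= M)%N].
  by rewrite !mem_pairs !mem_iota !mem_zrange /=; lia.
case/or3P: cases => /and3P[]; [move=> x0 n0 nx|move=> n0 zx nA|move=> x0 xz An].
- have h1 : 0 <= n * z%:Z by rewrite mulr_ge0.
  have h2 : A%:Z * x <= M%:Z by lia.
  have /andP[h3 h4] : (A%:Z <= A%:Z * x) && (x <= A%:Z * x) by apply: ler_posM; lia.
  have [n00|n1] := eqVneq n 0; first by apply/and4P; split; lia.
  have /andP[h5 h6] : (n <= n * z%:Z) && (z%:Z <= n * z%:Z) by apply: ler_posM; lia.
  have h7 : 0 <= A%:Z * x by rewrite mulr_ge0 //; lia.
  by apply/and4P; split; lia.
- have h1 : (- (2 * n)) * (2 * z%:Z) <= (A%:Z - 1) * (x - 1) by apply: ler_pM; lia.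
  have h2 : A%:Z + x <= M%:Z + 1 by lia.
  by apply/and4P; split; lia.
- have h1 : A%:Z * (- x) <= (2 * n - 1) * (2 * z%:Z - 1) by apply: ler_pM; lia.
  have h2 : 2 * n + 2 * z%:Z <= M%:Z + 1 by lia.
  by apply/and4P; split; lia.
Qed.

Lemma mixed_sol_box a x n y : mixed_sol ((a, x), (n, y)) ->
  [&& 0 < a, 0 < x, 0 < n & 0 < y]%N -> ((a, x), (n, y)) \in box.
Proof.
move=> /andP[_ /eqP e] /and4P[a0 x0 n0 y0]; move: e => /= e.
rewrite !mem_pairs !mem_iota !add1n !ltnS.
by apply/andP; split; apply/andP; split; apply/andP; split=> //; nia.
Qed.

(** With A = a + 2 n and 2 z = |x - y| one has A x + 4 n z = a x + 2 n y after giving n the sign of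
    y - x, and chi(x) chi(y) = (-1)^z. *)
Lemma sum_add_mixed :
  \sum_(t <- box | mixed_sol t && (t.1.2 != t.2.2))
    chi t.1.2 * chi t.2.2 * F (t.1.1 + 2 * t.2.1)%N =
  \sum_(t <- zbox | left_sol t) (-1) ^+ t.2.2 * F t.1.1.
Proof.
pose h (t : (nat * nat) * (nat * nat)) : (nat * int) * (int * nat) :=
  let: ((a, x), (n, y)) := t in
  (((a + 2 * n)%N, x%:Z), (if (x < y)%N then n%:Z else - n%:Z, (x - y + (y - x))./2%N)).
pose k (t : (nat * int) * (int * nat)) : (nat * nat) * (nat * nat) :=
  let: ((A, x), (n, z)) := t in
  (((A - 2 * absz n)%N, absz x), (absz n, absz (if 0 < n then x + 2 * z%:Z else x - 2 * z%:Z))).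
apply: (sum_bij h k).
- exact: uniq_posbox4.
- exact: uniq_zbox.
- move=> [[a x] [n y]] /posbox4_gt0 bnd; rewrite /mixed_sol /= => /andP[/andP[oy /eqP e] ne].
  have oax : odd (a * x) by lia.
  have /andP[oa ox] : odd a && odd x by rewrite -oddM.
  have chiE : chi x * chi y = (-1) ^+ (x - y + (y - x))./2.
    by rewrite !chi_odd // -exprD; apply: eq_sign; lia.
  have hd : (2 * (x - y + (y - x))./2 = x - y + (y - x))%N by lia.
  rewrite chiE; move: hd; move: (_./2)%N => d hd.
  case: (ltnP x y) => xy.
  + have ls : left_sol ((a + 2 * n)%N, x%:Z, (n%:Z, d)).
      have := congr1 (muln n) hd; rewrite /left_sol /zsol; lia.
    split=> //.
    * by apply: zsol_box; [case/and5P: ls|rewrite ls].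
    * by apply: eq_quad; rewrite ?ifT; lia.
  + have ls : left_sol ((a + 2 * n)%N, x%:Z, (- n%:Z, d)).
      have := congr1 (muln n) hd; rewrite /left_sol /zsol; lia.
    split=> //.
    * by apply: zsol_box; [case/and5P: ls|rewrite ls].
    * by apply: eq_quad; rewrite ?ifF; lia.
- move=> [[A x] [n z]] _ ls /=.
  have {}ls : left_sol (A, x, (n, z)) by [].
  move: ls; rewrite /left_sol /zsol => /and5P[/and4P[oA ox z0 /eqP e] x0 n0 nA nx].
  rewrite /k /h; case: ifP => ns.
  + have ms : mixed_sol ((A - 2 * absz n)%N, absz x, (absz n, absz (x + 2 * z%:Z))).
      rewrite /mixed_sol /=.
      have [p [q [c [np xq Ac]]]] : exists p q c : nat, [/\ n = p%:Z, x = q%:Z & A = (c + 2 * p)%N].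
        by exists (absz n), (absz x), (A - 2 * absz n)%N; split; lia.
      have -> : (A - 2 * absz n)%N = c by lia.
      have -> : absz (x + 2 * z%:Z) = (q + 2 * z)%N by lia.
      have -> : absz n = p by lia.
      have -> : absz x = q by lia.
      by move: e; rewrite np xq Ac; lia.
    split.
    * by apply: mixed_sol_box => //; lia.
    * by rewrite ms /=; lia.
    * by apply: eq_quad; rewrite ?ifT; lia.
  + have ms : mixed_sol ((A - 2 * absz n)%N, absz x, (absz n, absz (x - 2 * z%:Z)%R)).
      rewrite /mixed_sol /=.
      have [p [q [c [np xq Ac]]]] : exists p q c : nat,
          [/\ n = - p%:Z, x = (q + 2 * z)%:Z & A = (c + 2 * p)%N].
        by exists (absz n), (absz x - 2 * z)%N, (A - 2 * absz n)%N; split; lia.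
      have -> : (A - 2 * absz n)%N = c by lia.
      have -> : absz (x - 2 * z%:Z)%R = q by lia.
      have -> : absz n = p by lia.
      have -> : absz x = (q + 2 * z)%N by lia.
      by move: e; rewrite np xq Ac; lia.
    split.
    * by apply: mixed_sol_box => //; lia.
    * by rewrite ms /=; lia.
    * by apply: eq_quad; rewrite ?ifF; lia.
Qed.


(** With A = |a - 2 n| and 2 z = x + y one has A x + 4 n z = a x + 2 n y after giving x the sign of
    a - 2 n. Here chi(x) chi(y) = - (-1)^z, whence the minus sign. *)
Lemma sum_sub_mixed :
  \sum_(t <- box | mixed_sol t)
    chi t.1.2 * chi t.2.2 * F ((t.1.1 - 2 * t.2.1) + (2 * t.2.1 - t.1.1))%N =
  \sum_(t <- zbox | right_sol t) - ((-1) ^+ t.2.2 * F t.1.1).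
Proof.
pose h (t : (nat * nat) * (nat * nat)) : (nat * int) * (int * nat) :=
  let: ((a, x), (n, y)) := t in
  (((a - 2 * n + (2 * n - a))%N, if (2 * n < a)%N then x%:Z else - x%:Z),
   (n%:Z, (x + y)./2%N)).
pose k (t : (nat * int) * (int * nat)) : (nat * nat) * (nat * nat) :=
  let: ((A, x), (n, z)) := t in
  (((if (0 < x)%R then A + 2 * absz n else 2 * absz n - A)%N, absz x),
   (absz n, (2 * z - absz x)%N)).
apply: (sum_bij h k).
- exact: uniq_posbox4.
- exact: uniq_zbox.
- move=> [[a x] [n y]] /posbox4_gt0 bnd; rewrite /mixed_sol /= => /andP[oy /eqP e].
  have oax : odd (a * x) by lia.
  have /andP[oa ox] : odd a && odd x by rewrite -oddM.
  have chiE : chi x * chi y = - (-1) ^+ (x + y)./2.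
    rewrite !chi_odd // -exprD -(mulN1r (_ ^+ _)) -exprS; apply: eq_sign; lia.
  have hd : (2 * (x + y)./2 = x + y)%N by lia.
  rewrite chiE mulNr; move: hd; move: (_./2)%N => d hd.
  case: (ltnP (2 * n)%N a) => na.
  + have [c ac] : exists c, a = (c + 2 * n)%N by exists (a - 2 * n)%N; lia.
    have -> : (a - 2 * n + (2 * n - a))%N = c by lia.
    have rs : right_sol (c, x%:Z, (n%:Z, d)).
      by have := congr1 (muln n) hd; rewrite /right_sol /zsol; move: e; rewrite ac; lia.
    split=> //.
    * by apply: zsol_box; [case/and4P: rs|rewrite rs !orbT].
    * by apply: eq_quad; rewrite ?ifT; lia.
  + have [c nc] : exists c, (2 * n = a + c)%N by exists (2 * n - a)%N; lia.
    have -> : (a - 2 * n + (2 * n - a))%N = c by lia.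
    have rs : right_sol (c, - x%:Z, (n%:Z, d)).
      have h1 := congr1 (muln n) hd; have h2 := congr1 (muln x) nc.
      by rewrite /right_sol /zsol; lia.
    split=> //.
    * by apply: zsol_box; [case/and4P: rs|rewrite rs !orbT].
    * by apply: eq_quad; rewrite ?ifF; lia.
- move=> [[A x] [n z]] _ ls /=.
  have {}ls : right_sol (A, x, (n, z)) by [].
  move: ls; rewrite /right_sol /zsol => /and4P[/and4P[oA ox z0 /eqP e] n0 xz xn].
  have [p np] : exists p : nat, n = p%:Z by exists (absz n); lia.
  move: n0 e xn; rewrite /k /h np /= => n0 e xn; case: ifP => xs.
  + have [q xq] : exists q : nat, x = q%:Z by exists (absz x); lia.
    have [y zy] : exists y : nat, (2 * z = y + q)%N by exists (2 * z - absz x)%N; lia.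
    have -> : (2 * z - absz x)%N = y by lia.
    have ms : mixed_sol ((A + 2 * p)%N, absz x, (p, y)).
      rewrite /mixed_sol /= xq /=; have := congr1 (muln p) zy; move: e; rewrite xq; lia.
    split.
    * by apply: mixed_sol_box => //; lia.
    * by rewrite ms.
    * by apply: eq_quad; rewrite ?ifT; lia.
  + have [q xq] : exists q : nat, x = - q%:Z by exists (absz x); lia.
    have [y zy] : exists y : nat, (2 * z = y + q)%N by exists (2 * z - absz x)%N; lia.
    have [a pa] : exists a : nat, (2 * p = a + A)%N by exists (2 * p - A)%N; lia.
    have -> : (2 * z - absz x)%N = y by lia.
    have -> : (2 * p - A)%N = a by lia.
    have ms : mixed_sol (a, absz x, (p, y)).
      rewrite /mixed_sol /=; have -> : absz x = q by lia.
      have h1 := congr1 (muln p) zy; have h2 := congr1 (muln q) pa; move: e; rewrite xq; lia.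
    split.
    * by apply: mixed_sol_box => //; lia.
    * by rewrite ms.
    * by apply: eq_quad; rewrite ?ifF; lia.
Qed.

Lemma centered_mod (d : nat) (m x : int) : (0 < d)%N -> `|x| < d%:Z ->
  ((m * (2 * d%:Z) + x + d%:Z) %/ (2 * d%:Z))%Z = m.
Proof.
move=> d0 xd; rewrite -addrA divzMDl; last lia.
by rewrite divz_small ?addr0 //; lia.
Qed.

(** The parity condition excludes the residue -d modulo 2 d, so the centred residue lies strictly
    between -d and d. *)
Lemma centered_modP (d : nat) (x : int) : (0 < d)%N -> ((x - d%:Z) %% 2 != 0)%Z ->
  exists m r, [/\ x = m * (2 * d%:Z) + r & `|r| < d%:Z].
Proof.
move=> d0 xd.
have e := divz_eq (x + d%:Z) (2 * d%:Z).
have r0 : 0 <= ((x + d%:Z) %% (2 * d%:Z))%Z by apply: modz_ge0; lia.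
have r1 : ((x + d%:Z) %% (2 * d%:Z))%Z < 2 * d%:Z by apply: ltz_pmod; lia.
move: e r0 r1; set q := (_ %/ _)%Z; set r := (_ %% _)%Z => e r0 r1.
exists q, (r - d%:Z); split; first lia.
have rn : r != 0.
  apply: contraNneq xd => rz; apply/eqP.
  have -> : x - d%:Z = (q * d%:Z - d%:Z) * 2 by move: e; rewrite rz; lia.
  by rewrite modzMl.
by lia.
Qed.

(* Solutions (x, n) of A x + 4 n z = M for fixed A, z are permuted by
   (x, n) -> (x - 4 z m, n + A m); m is chosen to centre x, resp. n. *)
Lemma sum_far :
  \sum_(t <- zbox | far_x t) (-1) ^+ t.2.2 * F t.1.1 =
  \sum_(t <- zbox | far_n t) (-1) ^+ t.2.2 * F t.1.1.
Proof.
pose h (t : (nat * int) * (int * nat)) : (nat * int) * (int * nat) :=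
  let: ((A, x), (n, z)) := t in
  let m := ((x + (2 * z)%:Z) %/ (2 * (2 * z)%:Z))%Z in
  ((A, x - m * (2 * (2 * z)%:Z)), (n + m * A%:Z, z)).
pose k (t : (nat * int) * (int * nat)) : (nat * int) * (int * nat) :=
  let: ((A, x), (n, z)) := t in
  let m := ((2 * n + A%:Z) %/ (2 * A%:Z))%Z in
  ((A, x + m * (2 * (2 * z)%:Z)), (n - m * A%:Z, z)).
apply: (sum_bij h k).
- exact: uniq_zbox.
- exact: uniq_zbox.
- move=> [[A x] [n z]] _ ls.
  have {}ls : far_x (A, x, (n, z)) by [].
  move: ls; rewrite /far_x /zsol => /and3P[/and4P[oA ox z0 /eqP e] zx nA].
  have d0 : (0 < 2 * z)%N by lia.
  have xd : ((x - (2 * z)%:Z) %% 2 != 0)%Z by lia.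
  have [m [r [xE rz]]] := centered_modP d0 xd.
  (* From x > 2 z and |r| < 2 z; then 2 (n + m A) > -A + 2 A = A, as [far_n] demands. *)
  have m1 : 1 <= m by nia.
  have hE : h (A, x, (n, z)) = (A, r, (n + m * A%:Z, z)).
    by rewrite /h xE centered_mod //=; apply: eq_quad; lia.
  have fn : far_n (A, r, (n + m * A%:Z, z)).
    rewrite /far_n /zsol; apply/and3P; split; [apply/and4P; split|lia|] => //.
    - by lia.
    - by rewrite -e xE; apply/eqP; ring.
    - have : A%:Z <= m * A%:Z by rewrite ler_peMl.
      by lia.
  rewrite hE; split => //.
  + by apply: zsol_box; [case/and3P: fn|rewrite fn !orbT].
  + rewrite /k.
    have -> : 2 * (n + m * A%:Z) + A%:Z = m * (2 * A%:Z) + 2 * n + A%:Z by ring.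
    by rewrite centered_mod //=; [apply: eq_quad; lia|lia].
- move=> [[A x] [n z]] _ ls.
  have {}ls : far_n (A, x, (n, z)) by [].
  move: ls; rewrite /far_n /zsol => /and3P[/and4P[oA ox z0 /eqP e] xz nA].
  have d0 : (0 < A)%N by lia.
  have xd : ((2 * n - A%:Z) %% 2 != 0)%Z by lia.
  have [m [r [nE rA]]] := centered_modP d0 xd.
  have m1 : 1 <= m by nia.
  have hE : k (A, x, (n, z)) = (A, x + m * (2 * (2 * z)%:Z), (n - m * A%:Z, z)).
    by rewrite /k nE centered_mod //; lia.
  have fx : far_x (A, x + m * (2 * (2 * z)%:Z), (n - m * A%:Z, z)).
    rewrite /far_x /zsol; apply/and3P; split; [apply/and4P; split| |lia] => //.
    - by lia.
    - by rewrite -e; apply/eqP; ring.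
    - have : (2 * z)%:Z <= m * (2 * z)%:Z by rewrite ler_peMl.
      by lia.
  rewrite hE; split => //.
  + by apply: zsol_box; [case/and3P: fx|rewrite fx !orbT].
  + rewrite /h.
    have -> : x + m * (2 * (2 * z)%:Z) = m * (2 * (2 * z)%:Z) + x by ring.
    by rewrite centered_mod //=; [apply: eq_quad; lia|lia].
Qed.

(** If x = y then A x = M for A = a + 2 n, and for odd A there are (A - 1)/2 values n >= 1 with 2 n
    < A; the sign is chi(x)^2 = 1. *)
Lemma sum_add_diag :
  \sum_(t <- box | mixed_sol t && (t.1.2 == t.2.2))
    chi t.1.2 * chi t.2.2 * F (t.1.1 + 2 * t.2.1)%N =
  \sum_(p <- posbox2 M | (p.1 * p.2 == M)%N) F p.1 *+ p.1./2.
Proof.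
under [RHS]eq_bigr => p _ do rewrite -[p.1./2]subn0 -sumr_const_nat.
rewrite -sum_posbox3; last by move=> [d e]; rewrite mem_pairs !mem_iota /=; lia.
apply: (sum_bij (fun t => ((t.1.1 + 2 * t.2.1, t.1.2), t.2.1.-1))
  (fun q => ((q.1.1 - 2 * q.2.+1, q.1.2), (q.2.+1, q.1.2)))%N).
- exact: uniq_posbox4.
- exact: uniq_posbox3.
- move=> [[a x] [n y]] /posbox4_gt0 bnd; rewrite /mixed_sol /= => /andP[/andP[oy /eqP e] /eqP xy].
  subst y.
  have e' : ((a + 2 * n) * x = M)%N by lia.
  have oax : odd ((a + 2 * n) * x) by rewrite e'.
  have /andP[oa ox] : odd (a + 2 * n) && odd x by rewrite -oddM.
  have b1 : (a + 2 * n <= M)%N by rewrite -e' leq_pmulr; lia.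
  have b2 : (x <= M)%N by rewrite -e' leq_pmull; lia.
  split.
  + by rewrite !mem_pairs !mem_iota /=; lia.
  + by rewrite e' eqxx; lia.
  + by apply: eq_quad; lia.
  + by rewrite chi_odd // -exprD addnn -signr_odd odd_double mul1r.
- move=> [[A x] k]; rewrite !mem_pairs !mem_iota /= => bnd /andP[/eqP e kA].
  have oax : odd (A * x) by rewrite e.
  have /andP[oa ox] : odd A && odd x by rewrite -oddM.
  have [a Aa] : exists a, A = (a + 2 * k.+1)%N by exists (A - 2 * k.+1)%N; lia.
  have ms : mixed_sol ((A - 2 * k.+1)%N, x, (k.+1, x)).
    by rewrite /mixed_sol ox Aa addnK /=; apply/eqP; rewrite -e Aa; ring.
  split.
  + by lia.
  + by rewrite ms /=.
  + by congr (_, _, _); lia.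
Qed.

Lemma sum_sign m : \sum_(0 <= k < m) (-1) ^+ k.+1 = - (odd m)%:Z.
Proof.
elim: m => [|m IH]; first by rewrite big_nil.
by rewrite big_nat_recr //= IH -signr_odd /=; case: (odd m).
Qed.

(** If n = 0 then A x = M and z runs from 1 to (x - 1)/2; the alternating sum of (-1)^z is -1 or
    0. *)
Lemma sum_far_diag :
  \sum_(t <- zbox | far_x t && (t.2.1 == 0)) (-1) ^+ t.2.2 * F t.1.1 =
  \sum_(p <- posbox2 M | (p.1 * p.2 == M)%N) F p.1 * - (odd p.2./2)%:Z.
Proof.
under [RHS]eq_bigr => p _ do rewrite -sum_sign mulr_sumr.
rewrite -(sum_posbox3 (fun p k => F p.1 * (-1) ^+ k.+1));
  last by move=> [d e]; rewrite mem_pairs !mem_iota /=; lia.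
pose h (t : (nat * int) * (int * nat)) := ((t.1.1, absz t.1.2), t.2.2.-1).
pose k (q : (nat * nat) * nat) := ((q.1.1, q.1.2%:Z), (0%:Z, q.2.+1)).
apply: (sum_bij h k).
- exact: uniq_zbox.
- exact: uniq_posbox3.
- move=> [[A x] [n z]] _ ls.
  have {}ls : far_x (A, x, (n, z)) && (n == 0) by [].
  case/andP: ls => /and3P[/and4P[oA ox z0 /eqP e] zx nA] n0.
  have [q xq] : exists q : nat, x = q%:Z by exists (absz x); lia.
  have e' : (A * q = M)%N by move: e; rewrite xq (eqP n0); lia.
  have b1 : (A <= M)%N by rewrite -e' leq_pmulr; lia.
  have b2 : (q <= M)%N by rewrite -e' leq_pmull; lia.
  rewrite /h /k /= xq /=; split.
  + by rewrite !mem_pairs !mem_iota /=; lia.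
  + by rewrite e' eqxx; lia.
  + by apply: eq_quad; lia.
  + by rewrite prednK // mulrC.
- move=> [[A x] m]; rewrite !mem_pairs !mem_iota /= => bnd /andP[/eqP e kA].
  have oax : odd (A * x) by rewrite e.
  have /andP[oa ox] : odd A && odd x by rewrite -oddM.
  have fx : far_x (k (A, x, m)).
    by rewrite /far_x /k /zsol /=; lia.
  split.
  + by rewrite !mem_zrange; lia.
  + by move: fx; rewrite /k /= => ->.
  + by rewrite /h /k.
Qed.

(** The terms with a + 2 n and x <> y and those with |a - 2 n| cancel on the common part of
    [left_sol] and [right_sol], and by [sum_far] on the rest, up to the terms n = 0. These and the
    diagonal x = y give the right-hand side. *)
Lemma liouville_odd :
  \sum_(t <- box | mixed_sol t) chi t.1.2 * chi t.2.2 *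
    (F (t.1.1 + 2 * t.2.1)%N + F ((t.1.1 - 2 * t.2.1) + (2 * t.2.1 - t.1.1))%N) *+ 2 =
  \sum_(p <- posbox2 M | (p.1 * p.2 == M)%N) F p.1 * (p.1%:Z - chi p.2).
Proof.
rewrite sumrMnl; under eq_bigr do rewrite mulrDr.
rewrite big_split /= sum_sub_mixed sumrN.
rewrite (bigID (fun t => t.1.2 == t.2.2)) /= sum_add_diag sum_add_mixed.
rewrite (bigID right_sol) [X in _ - X](bigID left_sol) /=.
have -> : \sum_(t <- zbox | right_sol t && left_sol t) (-1) ^+ t.2.2 * F t.1.1 =
    \sum_(t <- zbox | left_sol t && right_sol t) (-1) ^+ t.2.2 * F t.1.1.
  by apply: eq_bigl => t; rewrite andbC.
have -> : \sum_(t <- zbox | right_sol t && ~~ left_sol t) (-1) ^+ t.2.2 * F t.1.1 =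
    \sum_(t <- zbox | far_n t) (-1) ^+ t.2.2 * F t.1.1.
  apply: eq_bigl => -[[A x] [n z]].
  by rewrite /left_sol /right_sol /far_n; case: (boolP (zsol _)) => //= /and4P[? ? ? _]; lia.
have -> : \sum_(t <- zbox | left_sol t && ~~ right_sol t) (-1) ^+ t.2.2 * F t.1.1 =
    \sum_(t <- zbox | far_x t && ~~ (t.2.1 == 0)) (-1) ^+ t.2.2 * F t.1.1.
  apply: eq_bigl => -[[A x] [n z]].
  by rewrite /left_sol /right_sol /far_x; case: (boolP (zsol _)) => //= /and4P[? ? ? _]; lia.
rewrite -sum_far (bigID (fun t => t.2.1 == 0) far_x) /= sum_far_diag.
rewrite [X in X *+ 2 = _](_ : _ =
  \sum_(p <- posbox2 M | (p.1 * p.2 == M)%N) F p.1 *+ p.1./2 -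
  \sum_(p <- posbox2 M | (p.1 * p.2 == M)%N) F p.1 * - (odd p.2./2)%:Z); last by ring.
rewrite -sumrB -sumrMnl big_seq_cond [RHS]big_seq_cond; apply: eq_bigr => -[A x] /=.
rewrite mem_pairs !mem_iota => /andP[_ /eqP e].
have oax : odd (A * x) by rewrite e.
have /andP[oa ox] : odd A && odd x by rewrite -oddM.
(* With e = 1 if (x - 1)/2 is odd and e = 0 otherwise, 2 ((A - 1)/2 + e) = A - 1 + (1 - chi(x)) = A
   - chi(x). *)
rewrite chi_odd // -signr_odd -mulr_natr.
have -> : A%:Z = 1 + 2 * (A./2)%:Z by lia.
by case: (odd x./2); rewrite ?expr0 ?expr1 /=; ring.
Qed.

End Liouville2.

(** * Theta series *)

(** An injective image of part of a finite type is finite, so [fset_set] does not take its default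
    value and the count moves to that type. *)
Lemma card_fset_set_image (I : finType) (T : choiceType) (A : {pred I}) (g : I -> T) (S : set T) :
  injective g -> (forall y, S y <-> exists2 f, f \in A & g f = y) ->
  #|` fset_set S|%fset = #|A|.
Proof.
move=> gi SE.
have fS : finite_set S.
  have -> : S = [set` [fset g f | f in A]%fset]%classic.
    rewrite predeqE => y; rewrite SE /=; split=> [[f fA <-]|/imfsetP[f fA ->]]; last by exists f.
    by apply/imfsetP; exists f.
  exact: finite_fset.
have -> : fset_set S = [fset g f | f in A]%fset.
  apply/fsetP => y; rewrite in_fset_set //; apply/idP/imfsetP.
    by move=> /set_mem /SE[f fA <-]; exists f.
  by move=> [f fA ->]; apply/mem_set/SE; exists f.
by rewrite card_imfset //= cardE.
Qed.

Definition issq n := [exists k : 'I_n.+1, (k * k == n)%N].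
Definition istri n := [exists k : 'I_n.+1, ((k * k.+1)./2 == n)%N].

Lemma issqP n : reflect (exists s, (s * s)%N = n) (issq n).
Proof.
apply: (iffP existsP) => [[k /eqP e]|[s e]]; first by exists k.
have sn : (s < n.+1)%N by nia.
by exists (Ordinal sn); rewrite /= e.
Qed.

Lemma istriP n : reflect (exists k, (k * k.+1)%N = (2 * n)%N) (istri n).
Proof.
apply: (iffP existsP) => [[k /eqP e]|[s e]].
  by exists k; have := oddM k k.+1; lia.
have sn : (s < n.+1)%N by nia.
by exists (Ordinal sn); rewrite /= e; lia.
Qed.

Definition psi : fps := fun n => (istri n)%:Z.
Definition phi : fps := fun n => if n is 0 then 1 else 2 * (issq n)%:Z.

Lemma psi_eqm M : eqm M psi (\sum_(k < M.+1) mono (k * k.+1)./2).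
Proof.
move=> u uM; rewrite coef_fps_sum /psi /mono.
case: istriP => [[k e]|ne].
  have kM : (k < M.+1)%N by nia.
  rewrite (bigD1 (Ordinal kM)) //= big1 => [|i ne].
    by rewrite e; have -> : (u == (2 * u)./2) by lia.
  apply/eqP; rewrite eqz_nat eqb0; apply: contraNN ne => /eqP ue; apply/eqP/val_inj => /=.
  have : (i * i.+1 = k * k.+1)%N by rewrite e ue; have := oddM i i.+1; lia.
  by nia.
rewrite big1 // => i _; apply/eqP; rewrite eqz_nat eqb0; apply/eqP => ue.
by apply: ne; exists i; rewrite ue; have := oddM i i.+1; lia.
Qed.

(** The index k stands for the integer k - M; a square s^2 is hit by the indices M + s and M - s,
    which coincide only for s = 0. *)
Lemma phi_eqm M : eqm M phi (\sum_(k < (2 * M).+1) mono (absz (k%:Z - M%:Z)%R ^ 2)%N).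
Proof.
move=> u uM; rewrite coef_fps_sum /mono.
have f_eq (k : 'I_(2 * M).+1) s : u = (s * s)%N ->
    (u == absz (k%:Z - M%:Z)%R ^ 2)%N = (nat_of_ord k == M + s)%N || (nat_of_ord k == M - s)%N.
  move=> us; have sM : (s <= M)%N by nia.
  have -> : (u == absz (k%:Z - M%:Z)%R ^ 2)%N = (s == absz (k%:Z - M%:Z)%R).
    by rewrite us -[(s * s)%N]/(s ^ 2)%N eqn_exp2r.
  by lia.
case: (posnP u) => [u0|u0].
  subst u; have MM : (M < (2 * M).+1)%N by lia.
  rewrite (bigD1 (Ordinal MM)) // big1 => [|i ne]; first by rewrite (f_eq _ 0%N) //= addn0 eqxx.
  rewrite (f_eq _ 0%N) // addn0 subn0 orbb; apply/eqP; rewrite eqz_nat eqb0.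
  by apply: contraNN ne => /eqP e; apply/eqP/val_inj.
have -> : phi u = 2 * (issq u)%:Z by rewrite /phi; case: (u) u0.
case: issqP => [[s e]|ne].
  have sM : (0 < s <= M)%N by nia.
  have M1 : (M + s < (2 * M).+1)%N by lia.
  have M2 : (M - s < (2 * M).+1)%N by lia.
  rewrite (bigD1 (Ordinal M1)) // (bigD1 (Ordinal M2)); last by rewrite -val_eqE /=; lia.
  rewrite big1 => [|i /andP[n1 n2]].
    by rewrite !(f_eq _ s) //= !eqxx orbT.
  rewrite (f_eq _ s) //; move: n1 n2; rewrite -!val_eqE /= => n1 n2.
  by apply/eqP; rewrite eqz_nat eqb0; lia.
rewrite big1 // => i _; apply/eqP; rewrite eqz_nat eqb0; apply/eqP => ue.
by apply: ne; eexists; rewrite ue; exact/esym/mulnn.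
Qed.

Lemma delta_psi j n : (delta_ j n)%:Z = (psi ^+ j) n.
Proof.
rewrite (coef_fpsX_card j (@psi_eqm n)) //.
pose g (f : {ffun 'I_j -> 'I_n.+1}) : {ffun 'I_j -> nat} := [ffun i => nat_of_ord (f i)].
congr (_%:Z); apply: (card_fset_set_image (g := g)).
  move=> f f' /ffunP e; apply/ffunP => i; have := e i; rewrite !ffunE; exact: val_inj.
move=> y; rewrite /triangular_reps /=; split=> [e|[f fA <-]]; last first.
  by move: fA; rewrite inE => /eqP ->; apply: eq_bigr => i _; rewrite ffunE.
have yn i : (y i < n.+1)%N.
  rewrite ltnS e (bigD1 i) //=; apply: leq_trans (leq_addr _ _).
  by rewrite -divn2 leq_divRL //; nia.
exists [ffun i => Ordinal (yn i)]; last by apply/ffunP => i; rewrite !ffunE.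
by rewrite inE; apply/eqP; rewrite [LHS]e; apply: eq_bigr => i _; rewrite ffunE.
Qed.

Lemma r_phi j n : (r_ j n)%:Z = (phi ^+ j) n.
Proof.
rewrite (coef_fpsX_card j (@phi_eqm n)) //.
pose g (f : {ffun 'I_j -> 'I_(2 * n).+1}) : {ffun 'I_j -> int} :=
  [ffun i => (f i)%:Z - n%:Z].
congr (_%:Z); apply: (card_fset_set_image (g := g)).
  move=> f f' /ffunP e; apply/ffunP => i; have := e i; rewrite !ffunE => h.
  by move/addIr: h => -[] /ord_inj.
have sq (t : int) : t ^+ 2 = (absz t ^ 2)%N%:Z by rewrite -abszX; lia.
have Psum (I : Type) (r : seq I) (w : I -> nat) : (\sum_(i <- r) w i)%N%:Z = \sum_(i <- r) (w i)%:Z.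
  exact: (big_morph Posz PoszD (erefl _)).
move=> y; rewrite /square_reps /=; split=> [e|[f fA <-]]; last first.
  move: fA; rewrite inE => /eqP ->; rewrite Psum.
  by apply: eq_bigr => i _; rewrite ffunE sq.
have e' : n = (\sum_i absz (y i) ^ 2)%N.
  by apply/eqP; rewrite -eqz_nat Psum e; apply/eqP/eq_bigr => i _; rewrite sq.
have yn i : (absz (y i + n%:Z)%R < (2 * n).+1)%N.
  suff : (absz (y i) <= n)%N by lia.
  rewrite e' (bigD1 i) //=; apply: leq_trans (leq_addr _ _).
  by case: (absz (y i)) => // k; rewrite -mulnn leq_pmulr.
have yn0 i : 0 <= y i + n%:Z.
  suff : (absz (y i) <= n)%N by lia.
  rewrite e' (bigD1 i) //=; apply: leq_trans (leq_addr _ _).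
  by case: (absz (y i)) => // k; rewrite -mulnn leq_pmulr.
exists [ffun i => Ordinal (yn i)]; last by apply/ffunP => i; rewrite !ffunE /=;
  have := yn0 i; move: (y i) => t; lia.
rewrite inE; apply/eqP; rewrite [LHS]e'; apply: eq_bigr => i _; rewrite ffunE /=.
by congr (_ ^ 2)%N; have := yn0 i; move: (y i) => t; lia.
Qed.

(** * Functional equations of phi and psi *)

Lemma tri2 k : (2 * (k * k.+1)./2 = k * k.+1)%N.
Proof. by have := oddM k k.+1; lia. Qed.

Lemma coef_eqmM (I J : finType) (w : I -> nat) (v : J -> nat) n (f g : fps) :
  eqm n f (\sum_i mono (w i)) -> eqm n g (\sum_j mono (v j)) ->
  (f * g) n = \sum_i \sum_j (n == w i + v j)%N%:Z.
Proof.
move=> fE gE; rewrite (eqmM fE gE) // mulr_suml coef_fps_sum; apply: eq_bigr => i _.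
by rewrite mulr_sumr coef_fps_sum; apply: eq_bigr => j _; rewrite monoM.
Qed.

Lemma big_ord_pairs (V : zmodType) (F : nat -> nat -> V) m n :
  \sum_(i < m) \sum_(j < n) F i j =
  \sum_(p <- [seq (i, j) | i <- iota 0 m, j <- iota 0 n]) F p.1 p.2.
Proof.
rewrite big_allpairs -(big_mkord xpredT (fun i => \sum_(j < n) F i j)) /index_iota subn0.
by apply: eq_bigr => i _; rewrite -(big_mkord xpredT) /index_iota subn0.
Qed.

Lemma eqm_dil n f g : eqm n f g -> eqm n (dil f) (dil g).
Proof. by move=> fg u un; rewrite /dil; case: ifP => // _; rewrite fg //; lia. Qed.

Lemma big_pairs_eq (F : nat * nat -> nat) (s : seq (nat * nat)) n :
  \sum_(p <- s) (n == F p)%N%:Z = \sum_(p <- s | n == F p :> nat) 1 :> int.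
Proof. by rewrite [RHS]big_mkcond; apply: eq_bigr => p _; case: eqP. Qed.

(* T_k + T_l = s^2 + 2 T_t, where 2s and 2t+1 are, up to sign, the even and
   the odd one among k - l and k + l + 1. *)
Lemma psi_sqr : psi * psi = phi * dil psi.
Proof.
apply: funext => n.
have psiE := @psi_eqm n; have phiE := @phi_eqm n.
have dpsiE : eqm n (dil psi) (\sum_(k < n.+1) mono (2 * (k * k.+1)./2)).
  move=> u un; rewrite (eqm_dil psiE) // raddf_sum.
  by congr (_ u); apply: eq_bigr => k _; exact: dil_mono.
rewrite (coef_eqmM psiE psiE) (coef_eqmM phiE dpsiE).
rewrite (big_ord_pairs (fun k l => (n == (k * k.+1)./2 + (l * l.+1)./2)%N%:Z)).
rewrite (big_ord_pairs (fun k l => (n == absz (k%:Z - n%:Z)%R ^ 2 + 2 * (l * l.+1)./2)%N%:Z)).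
rewrite (big_pairs_eq (fun p => (p.1 * p.1.+1)./2 + (p.2 * p.2.+1)./2)%N).
rewrite (big_pairs_eq (fun p => absz (p.1%:Z - n%:Z)%R ^ 2 + 2 * (p.2 * p.2.+1)./2)%N).
(* As in [phi_eqm], the first component i encodes s as i - n. *)
pose h (p : nat * nat) := let: (k, l) := p in
  if odd (k + l) then
    (if l < k then (n + (k + l).+1./2, (k - l).-1./2) else (n - (k + l).+1./2, (l - k).-1./2))%N
  else (n + k./2 - l./2, (k + l)./2)%N.
pose h' (p : nat * nat) := let: (i, t) := p in
  if (n + t < i)%N then (i - n + t, i - n - t.+1)%N else
  if (i + t < n)%N then (n - i - t.+1, n - i + t)%N else (t + i - n, n + t - i)%N.
(* The cases of [h] without halving or truncated subtraction, with d = |s|: the first two have k + l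
   even, the last two have k + l odd. *)
pose rel k l d t i := [|| [&& i == n + d, k == t + d & t == l + d],
  [&& i + d == n, l == t + d & t == k + d], [&& i == n + d, k == d + t & d == l + t.+1] |
  [&& i + d == n, l == d + t & d == k + t.+1]]%N.
have relP k l d t i : n = (d * d + t * t.+1)%N -> rel k l d t i ->
    [/\ h (k, l) = (i, t), h' (i, t) = (k, l), (k <= n)%N && (l <= n)%N,
      (i <= 2 * n)%N && (t <= n)%N
    & (2 * n == k * k.+1 + l * l.+1)%N && (absz (i%:Z - n%:Z)%R == d)].
  move=> nE.
  have dn : (d <= n)%N by rewrite nE; nia.
  have tn : (t <= n)%N by rewrite nE; nia.
  have sq1 : (k = t + d -> t = l + d -> 2 * n = k * k.+1 + l * l.+1)%N.
    by rewrite nE => -> ->; ring.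
  have sq2 : (l = t + d -> t = k + d -> 2 * n = k * k.+1 + l * l.+1)%N.
    by rewrite nE => -> ->; ring.
  have sq3 : (k = d + t -> d = l + t.+1 -> 2 * n = k * k.+1 + l * l.+1)%N.
    by rewrite nE => -> ->; ring.
  have sq4 : (l = d + t -> d = k + t.+1 -> 2 * n = k * k.+1 + l * l.+1)%N.
    by rewrite nE => -> ->; ring.
  have kn : (2 * n = k * k.+1 + l * l.+1 -> k <= n /\ l <= n)%N by nia.
  case/or4P => /and3P[/eqP iE /eqP kE /eqP tE].
  - have e := sq1 kE tE; have [? ?] := kn e; move/eqP: e => ->; clear nE sq1 sq2 sq3 sq4 kn.
    split; [rewrite /h ifF; [congr pair; lia|lia]|
      rewrite /h'; do 2!(rewrite ifF; last lia); congr pair; lia|lia|lia|lia].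
  - have e := sq2 kE tE; have [? ?] := kn e; move/eqP: e => ->; clear nE sq1 sq2 sq3 sq4 kn.
    split; [rewrite /h ifF; [congr pair; lia|lia]|
      rewrite /h'; do 2!(rewrite ifF; last lia); congr pair; lia|lia|lia|lia].
  - have e := sq3 kE tE; have [? ?] := kn e; move/eqP: e => ->; clear nE sq1 sq2 sq3 sq4 kn.
    split; [rewrite /h ifT; [rewrite ifT; [congr pair; lia|lia]|lia]|
      rewrite /h'; rewrite ifT; [congr pair; lia|lia]|lia|lia|lia].
  - have e := sq4 kE tE; have [? ?] := kn e; move/eqP: e => ->; clear nE sq1 sq2 sq3 sq4 kn.
    split; [rewrite /h ifT; [rewrite ifF; [congr pair; lia|lia]|lia]|
      rewrite /h'; rewrite ifF; [rewrite ifT; [congr pair; lia|lia]|lia]|lia|lia|lia].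
apply: (sum_bij h h').
- by apply: allpairs_uniq; rewrite ?iota_uniq //; case=> [? ?] [? ?].
- by apply: allpairs_uniq; rewrite ?iota_uniq //; case=> [? ?] [? ?].
- move=> [k l]; rewrite !mem_pairs !mem_iota => bnd /eqP e.
  have e2 : (2 * n = k * k.+1 + l * l.+1)%N by rewrite {1}e mulnDr !tri2.
  have [d [t [i [r nE]]]] : exists d t i, rel k l d t i /\ n = (d * d + t * t.+1)%N.
    have [o|o] := boolP (odd (k + l)).
      have [lk|kl] := ltnP l k.
        exists (k + l).+1./2, (k - l).-1./2, (n + (k + l).+1./2)%N; split.
          by rewrite /rel; clear e e2; lia.
        have [t kE] : exists t, k = (l + (2 * t).+1)%N by exists (k - l).-1./2; clear e e2; lia.
        have -> : (k + l).+1./2 = (l + t.+1)%N by clear e e2; lia.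
        have -> : (k - l).-1./2 = t by clear e e2; lia.
        by move: e2; rewrite kE; clear; lia.
      have dn : ((k + l).+1./2 <= n)%N by nia.
      exists (k + l).+1./2, (l - k).-1./2, (n - (k + l).+1./2)%N; split.
        by rewrite /rel; clear e e2; lia.
      have [t lE] : exists t, l = (k + (2 * t).+1)%N by exists (l - k).-1./2; clear e e2; lia.
      have -> : (k + l).+1./2 = (k + t.+1)%N by clear e e2; lia.
      have -> : (l - k).-1./2 = t by clear e e2; lia.
      by move: e2; rewrite lE; clear; lia.
    have [lk|kl] := leqP l k.
      have [d kE] : exists d, k = (l + 2 * d)%N by exists (k - l)./2; clear e e2; lia.
      exists d, (l + d)%N, (n + d)%N; split; first by rewrite /rel; clear e e2; lia.
      by move: e2; rewrite kE; clear; lia.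
    have [d lE] : exists d, l = (k + 2 * d)%N by exists (l - k)./2; clear e e2; lia.
    have dn : (d <= n)%N by nia.
    exists d, (k + d)%N, (n - d)%N; split; first by rewrite /rel; clear e e2; lia.
    by move: e2; rewrite lE; clear; lia.
  have [hE hE' _ bi /andP[_ /eqP di]] := relP k l d t i nE r.
  rewrite hE !mem_pairs !mem_iota; split=> //.
  by rewrite /= di tri2 -mulnn; apply/eqP.
- move=> [i t] _ /eqP e; rewrite /= in e.
  have [d [k [l [r nE]]]] : exists d k l, rel k l d t i /\ n = (d * d + t * t.+1)%N.
    exists (absz (i%:Z - n%:Z)%R).
    have nE : n = (absz (i%:Z - n%:Z)%R * absz (i%:Z - n%:Z)%R + t * t.+1)%N.
      by rewrite {1}e tri2 mulnn.
    move: nE; set d := absz _ => nE.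
    have di : (i == n + d)%N || (i + d == n)%N by rewrite /d; clear; lia.
    clearbody d; have [td|dt] := ltnP t d.
      case/orP: di => /eqP di.
        by exists (d + t)%N, (d - t.+1)%N; split=> //; rewrite /rel; clear nE e; lia.
      by exists (d - t.+1)%N, (d + t)%N; split=> //; rewrite /rel; clear nE e; lia.
    case/orP: di => /eqP di.
      by exists (t + d)%N, (t - d)%N; split=> //; rewrite /rel; clear nE e; lia.
    by exists (t - d)%N, (t + d)%N; split=> //; rewrite /rel; clear nE e; lia.
  have [hE hE' bk _ /andP[/eqP e2 _]] := relP k l d t i nE r.
  rewrite hE' !mem_pairs !mem_iota; split=> //=.
  by have := tri2 k; have := tri2 l; lia.
Qed.

(** Even squares are 4 s^2, and odd squares are (2 t + 1)^2 = 8 T_t + 1, each with two roots. *)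
Lemma phi_split : phi = dil (dil phi) + X * dil (dil (dil psi)) *+ 2.
Proof.
apply: funext => n; rewrite coef_fpsD coef_fpsMn.
have phiS k : phi k.+1 = 2 * (issq k.+1)%:Z by [].
(* Residues 0 mod 4 and 1 mod 8 can contain squares; in the classes 2 mod 4, 3 mod 4 and 5 mod 8
   both sides vanish. *)
have : [\/ exists m, n = 2 * (2 * m), exists m, n = (2 * (2 * (2 * m))).+1,
    exists m, n = 2 * (2 * m).+1 | (exists m, n = (2 * (2 * m).+1).+1) \/
    exists m, n = (2 * (2 * (2 * m).+1)).+1]%N.
  have : [|| n %% 4 == 0, n %% 8 == 1, n %% 4 == 2, n %% 4 == 3 | n %% 8 == 5]%N by lia.
  case/or4P => [h|h|h|/orP[h|h]].
  - by constructor 1; exists (n %/ 4)%N; lia.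
  - by constructor 2; exists (n %/ 8)%N; lia.
  - by constructor 3; exists (n %/ 4)%N; lia.
  - by constructor 4; left; exists (n %/ 4)%N; lia.
  - by constructor 4; right; exists (n %/ 8)%N; lia.
case=> [[m ->]|[m ->]|[m ->]|[[m ->]|[m ->]]].
- rewrite !coef_dil2; case: m => [|m]; first by rewrite coef_XM0 mul0rn addr0.
  have -> : (2 * (2 * m.+1) = (2 * (2 * m).+1).+2)%N by lia.
  rewrite coef_XM coef_dil2S mul0rn addr0 !phiS; congr (_ * (nat_of_bool _)%:Z).
  apply/issqP/issqP => -[s e]; last by exists (2 * s)%N; nia.
  have [t st] : exists t, s = (2 * t)%N by exists s./2; have := oddM s s; lia.
  by exists t; rewrite st in e; lia.
- rewrite coef_dil2S add0r coef_XM !coef_dil2 phiS mulr_natl; congr ((nat_of_bool _)%:Z *+ 2).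
  apply/issqP/istriP => -[s e]; last first.
    by exists (2 * s).+1; lia.
  have [t st] : exists t, s = (2 * t).+1 by exists s./2; have := oddM s s; lia.
  by exists t; rewrite st in e; lia.
- rewrite coef_dil2 coef_dil2S mulnS coef_XM coef_dil2S mul0rn addr0 phiS.
  case: issqP => // -[s e]; have := oddM s s.
  by have : (s = 2 * s./2 + odd s)%N; [lia|move: (s./2) (odd s) => t []; nia].
- rewrite coef_dil2S coef_XM coef_dil2 coef_dil2S mul0rn addr0 phiS.
  case: issqP => // -[s e].
  have [t st] : exists t, s = (2 * t).+1 by exists s./2; have := oddM s s; lia.
  by rewrite st in e; lia.
- rewrite coef_dil2S coef_XM !coef_dil2 coef_dil2S mul0rn addr0 phiS.
  case: issqP => // -[s e].
  have [t st] : exists t, s = (2 * t).+1 by exists s./2; have := oddM s s; lia.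
  by rewrite st in e; have := oddM t t.+1; lia.
Qed.

(** The constant term equals its own negative, and every other coefficient is zero or minus one of
    smaller index. *)
Lemma fps_dil_opp_eq0 (f : fps) : f = - dil f -> f = 0.
Proof.
move=> fE; apply: funext => n; elim/ltn_ind: n => n IH.
have [n0|n0] := posnP n.
  have := congr1 (fun g : fps => g 0%N) fE; rewrite n0 coef_fpsN /dil /=.
  by change ((0 : fps) 0%N) with (0 : int); lia.
rewrite fE coef_fpsN /dil; case: ifP => _; first by rewrite oppr0.
by rewrite IH ?oppr0 //; lia.
Qed.

(** Let D(q) be the difference of the two sides. Squaring [phi_split] and using phi(q^4) psi(q^8) =
    psi(q^4)^2 gives D(q) = - D(q^2). *)
Lemma phi_sqr : phi ^+ 2 = dil (phi ^+ 2) + X * dil (dil (psi ^+ 2)) *+ 4.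
Proof.
apply/eqP; rewrite -subr_eq0; apply/eqP; apply: fps_dil_opp_eq0.
have e : phi ^+ 2 = dil (dil (phi ^+ 2)) + X * dil (dil (psi ^+ 2)) *+ 4 +
    X ^+ 2 * dil (dil (dil (psi ^+ 2))) *+ 4.
  have ab : dil (dil phi) * dil (dil (dil psi)) = dil (dil (psi ^+ 2)).
    by rewrite expr2 psi_sqr !rmorphM.
  by rewrite {1}phi_split -{1}ab !rmorphXn /=; ring.
have dX : dil X = X ^+ 2 by rewrite dil_mono expr2 monoM.
rewrite !(rmorphB, rmorphD, rmorphMn, rmorphM dil) /= dX {1}e; ring.
Qed.

(* For n > 0 the first equation gives 2 Q_n + ... = P_n + ..., where all other
   terms involve Q_m with m < n only, and the second gives P_n. *)
Lemma dissection_unique (P Q P' Q' : fps) :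
  Q ^+ 2 = P * dil Q -> P = dil P + X * dil (dil Q) *+ 4 ->
  Q' ^+ 2 = P' * dil Q' -> P' = dil P' + X * dil (dil Q') *+ 4 ->
  P 0%N = P' 0%N -> Q 0%N = 1 -> Q' 0%N = 1 -> P = P' /\ Q = Q'.
Proof.
move=> QQ PP QQ' PP' P0 Q0 Q0'.
suff e n : P n = P' n /\ Q n = Q' n by split; apply: funext => n; have [] := e n.
elim/ltn_ind: n => n IH; case: n IH => [|n] IH; first by rewrite Q0 Q0'.
have Pn : P n.+1 = P' n.+1.
  rewrite PP PP' !coef_fpsD !coef_fpsMn !coef_XM /dil /=.
  have [-> _] := IH (uphalf n) ltac:(lia); have [_ ->] // := IH n./2./2 ltac:(lia).
split=> //.
have eP : eqm n.+1 P P'.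
  by move=> u un; have [->|] := eqVneq u n.+1; [|move=> ne; have [] := IH u ltac:(lia)].
have eQ : eqm n.+1 (dil Q) (dil Q').
  by move=> u un; rewrite /dil; case: ifP => // _; have [] := IH u./2 ltac:(lia).
have := eqmM eP eQ (leqnn _); rewrite -QQ -QQ' => e.
(* All lower coefficients of Q - Q' vanish and Q + Q' has constant term 2, so this coefficient is
   twice that of Q - Q'. *)
have : ((Q - Q') * (Q + Q')) n.+1 = 0 by rewrite -subr_sqr coef_fpsB e subrr.
rewrite coef_fpsM big_ord_recr /= subnn big1 => [|i _].
  by rewrite add0r coef_fpsB coef_fpsD Q0 Q0'; lia.
by rewrite coef_fpsB; have [_ ->] := IH i (ltn_ord i); rewrite subrr mul0r.
Qed.

(** * Divisor series *)

(* In MathComp [divisors 0] is [:: 1], hence the case distinction. *)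
Definition lam (f : nat -> nat -> int) : fps :=
  fun m => if m is 0 then 0 else \sum_(d <- divisors m) f d (m %/ d)%N.

Lemma sum_divisors (V : zmodType) (f : nat -> nat -> V) B m : (0 < m <= B)%N ->
  \sum_(d <- divisors m) f d (m %/ d)%N = \sum_(p <- posbox2 B | (p.1 * p.2 == m)%N) f p.1 p.2.
Proof.
case/andP=> m0 mB.
apply: (sum_bij (fun d => (d, m %/ d)%N) fst).
- exact: divisors_uniq.
- exact: uniq_posbox2.
- move=> d; rewrite -dvdn_divisors // => dm _; have e := divnK dm.
  rewrite mem_pairs !mem_iota /= mulnC e eqxx; split=> //.
  have d0 := dvdn_gt0 m0 dm; have dB := leq_trans (dvdn_leq m0 dm) mB.
  have q0 : (0 < m %/ d)%N by rewrite divn_gt0 // dvdn_leq.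
  by rewrite d0 q0 !add1n !ltnS dB (leq_trans (leq_div m d) mB).
- move=> [d e]; rewrite mem_pairs !mem_iota /= => bnd /eqP de.
  have dd : (d %| m)%N by rewrite -de dvdn_mulr.
  by rewrite -dvdn_divisors // dd -de mulKn //; lia.
Qed.

Lemma lamE f B m : (m <= B)%N ->
  lam f m = \sum_(p <- posbox2 B | (p.1 * p.2 == m)%N) f p.1 p.2.
Proof.
case: m => [_|m mB]; last by rewrite /lam (@sum_divisors _ _ B) //.
rewrite /= big_seq_cond big_pred0 // => -[d e].
by rewrite mem_pairs !mem_iota /=; nia.
Qed.

Lemma eq_lam f g m : (forall a x, (a * x = m)%N -> f a x = g a x) -> lam f m = lam g m.
Proof.
case: m => [//|m] fg; rewrite /lam !big_seq; apply: eq_bigr => d.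
rewrite -dvdn_divisors // => dm.
by apply: fg; rewrite mulnC divnK.
Qed.

Lemma lam_swap f m : lam f m = lam (fun a x => f x a) m.
Proof.
rewrite !(@lamE _ m) //; apply: (sum_bij (fun p => (p.2, p.1)) (fun p => (p.2, p.1)));
  rewrite ?uniq_posbox2 // => -[d e]; rewrite !mem_pairs !mem_iota /= => bnd /eqP de;
  by rewrite mulnC de eqxx; split=> //; lia.
Qed.

(** Products of divisor series thus become sums over a x + b y = M, the shape of the Liouville
    identities. *)
Lemma coef_lamM f g M :
  (lam f * lam g) M = \sum_(t <- posbox4 M | (t.1.1 * t.1.2 + t.2.1 * t.2.2 == M)%N)
    f t.1.1 t.1.2 * g t.2.1 t.2.2.
Proof.
exact: (coefM_weighted (fun u uM => lamE f uM) (fun u uM => lamE g uM)).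
Qed.

Lemma coef_lamM_dil f g M :
  (lam f * dil (lam g)) M = \sum_(t <- posbox4 M | (t.1.1 * t.1.2 + 2 * t.2.1 * t.2.2 == M)%N)
    f t.1.1 t.1.2 * g t.2.1 t.2.2.
Proof.
have h u : (u <= M)%N ->
    dil (lam g) u = \sum_(q <- posbox2 M | (2 * q.1 * q.2 == u)%N) g q.1 q.2.
  move=> uM; rewrite /dil; case: ifP => ou.
    by rewrite big_pred0 // => q; rewrite -mulnA; lia.
  by rewrite (@lamE _ M); [apply: eq_bigl => q; rewrite -mulnA|]; lia.
exact: (coefM_weighted (fun u uM => lamE f uM) h).
Qed.

(** * Divisor series of the character and of sigma *)

Definition chi_series : fps := lam (fun d _ => chi d).
(** [psi2_series], [phi2_series] and [sigma_series] are Q, P and S; the first two will turn out to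
    be psi^2 and phi^2. *)
Definition psi2_series : fps := fun m => chi_series (4 * m).+1.
Definition phi2_series : fps := 1 + chi_series *+ 4.
Definition sigma_series : fps := fun n => (sigma (2 * n).+1)%:Z.

Lemma chiM m n : chi (m * n)%N = chi m * chi n.
Proof. by have [_ ->] := chi_m4_dirichlet int. Qed.

Lemma chi_sqr n : odd n -> chi n * chi n = 1.
Proof. by move=> on; rewrite chi_odd // -exprD addnn -signr_odd odd_double. Qed.

(** If a x = n then chi(a) chi(x) = -1, so complementary divisors contribute opposite values. *)
Lemma chi_series_mod3 n : (n %% 4 = 3)%N -> chi_series n = 0.
Proof.
move=> n3; have on : odd n by lia.
suff : chi_series n = - chi_series n by lia.
have cn : chi n = -1 by rewrite /chi_m4 n3.
rewrite {1}/chi_series lam_swap -coef_fpsN; have -> : - chi_series = lam (fun a _ => - chi a).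
  by apply: funext => -[|m]; rewrite coef_fpsN /chi_series /lam ?oppr0 // sumrN.
apply: eq_lam => a x ax; have := chiM a x; rewrite ax cn => e.
have /andP[oa _] : odd a && odd x by rewrite -oddM ax.
have := chi_sqr oa => sa; apply/eqP; rewrite -[chi x]mul1r -sa -mulrA -e; lia.
Qed.

(** Only odd divisors count, and 2 v and v have the same ones. *)
Lemma chi_series_double v : chi_series (2 * v) = chi_series v.
Proof.
rewrite /chi_series !(@lamE _ (2 * v)); [|lia..].
have restrict m : \sum_(p <- posbox2 (2 * v) | (p.1 * p.2 == m)%N) chi p.1 =
    \sum_(p <- posbox2 (2 * v) | (p.1 * p.2 == m)%N && odd p.1) chi p.1.
  rewrite (bigID (fun p => odd p.1)) /= [X in _ + X]big1 ?addr0 // => p /andP[_ op].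
  by rewrite chi_even.
rewrite !restrict.
apply: (sum_bij (fun p => (p.1, p.2./2)) (fun p => (p.1, 2 * p.2)))%N; rewrite ?uniq_posbox2 //.
- move=> [a x]; rewrite !mem_pairs !mem_iota /= => bnd /andP[/eqP ax oa].
  have ex : ~~ odd x by have := oddM a x; rewrite ax oa; lia.
  have [y xy] : exists y, x = (2 * y)%N by exists x./2; lia.
  have -> : x./2 = y by lia.
  by rewrite oa xy; split=> //; move: bnd ax; rewrite xy; lia.
- move=> [a x]; rewrite !mem_pairs !mem_iota /= => bnd /andP[/eqP ax oa].
  have xv : (x <= v)%N by rewrite -ax leq_pmull; lia.
  by rewrite oa; split; [lia|lia|congr pair; lia].
Qed.

Lemma phi2_series_split : phi2_series = dil phi2_series + X * dil (dil psi2_series) *+ 4.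
Proof.
suff e : chi_series = dil chi_series + X * dil (dil psi2_series).
  by rewrite /phi2_series rmorphD rmorph1 rmorphMn /= {1}e; ring.
apply: funext => n; rewrite coef_fpsD.
have : [\/ exists m, n = 2 * m, exists m, n = (2 * (2 * m)).+1
    | exists m, n = (2 * (2 * m).+1).+1]%N.
  have : [|| n %% 2 == 0, n %% 4 == 1 | n %% 4 == 3]%N by lia.
  case/or3P => h.
  - by constructor 1; exists (n %/ 2)%N; lia.
  - by constructor 2; exists (n %/ 4)%N; lia.
  - by constructor 3; exists (n %/ 4)%N; lia.
case=> [[m ->]|[m ->]|[m ->]].
- rewrite coef_dil2 chi_series_double; case: m => [|m]; first by rewrite coef_XM0 addr0.
  by rewrite mulnS coef_XM coef_dil2S addr0.
- by rewrite coef_dil2S add0r coef_XM !coef_dil2 /psi2_series; congr (chi_series _); lia.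
- by rewrite coef_dil2S add0r coef_XM coef_dil2 coef_dil2S chi_series_mod3 //; lia.
Qed.

(** This is the odd part of [chi_series]: chi(a) forces a odd, and exponents 3 mod 4 drop out by
    [chi_series_mod3]. *)
Lemma lam_chi_odd : lam (fun a x => chi a * (odd x)%:Z) = X * dil (dil psi2_series).
Proof.
apply: funext => -[|n]; first by rewrite coef_XM0.
rewrite coef_XM; case: (boolP (odd n)) => on.
  rewrite /dil on.
  rewrite (@eq_lam _ (fun _ _ => 0)) => [|a x ax]; first by rewrite /lam big1.
  have := oddM a x; rewrite ax /= on /=.
  by case: (boolP (odd x)) => ox; [rewrite andbT => /esym/negbT ea; rewrite chi_even|rewrite mulr0].
have -> : lam (fun a x => chi a * (odd x)%:Z) n.+1 = chi_series n.+1.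
  apply: eq_lam => a x ax; have := oddM a x; rewrite ax /= on => /esym/andP[_ ->].
  by rewrite mulr1.
have [m ->] : exists m, n = (2 * m)%N by exists n./2; lia.
rewrite coef_dil2; case: (boolP (odd m)) => om.
  by rewrite /dil om chi_series_mod3 //; lia.
have [k ->] : exists k, m = (2 * k)%N by exists m./2; lia.
by rewrite coef_dil2 /psi2_series; congr (chi_series _); lia.
Qed.

Lemma sigmaE B m : (0 < m <= B)%N ->
  (sigma m)%:Z = \sum_(p <- posbox2 B | (p.1 * p.2 == m)%N) p.1%:Z.
Proof.
move=> mB; rewrite /sigma (big_morph Posz PoszD (erefl _)).
exact: (sum_divisors (fun d _ => d%:Z) mB).
Qed.

Lemma lam_id_odd : lam (fun a x => a%:Z * (odd a && odd x)%:Z) = X * dil sigma_series.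
Proof.
apply: funext => -[|n]; first by rewrite coef_XM0.
rewrite coef_XM; case: (boolP (odd n)) => on.
  rewrite /dil on (@eq_lam _ (fun _ _ => 0)) => [|a x ax]; first by rewrite /lam big1.
  by rewrite -oddM ax /= on mulr0.
have [m ->] : exists m, n = (2 * m)%N by exists n./2; lia.
rewrite coef_dil2 /sigma_series (sigmaE (B := (2 * m).+1)) ?leqnn //.
rewrite (@lamE _ (2 * m).+1) //; apply: eq_bigr => p /eqP e.
by rewrite -oddM e /= oddM /= mulr1.
Qed.

(** * Products evaluated by the Liouville identities *)

Lemma big_odd_sol M (G : (nat * nat) * (nat * nat) -> int) :
  (forall t, ~~ [&& odd t.1.1, odd t.1.2, odd t.2.1 & odd t.2.2] -> G t = 0) ->
  \sum_(t <- posbox4 M | (t.1.1 * t.1.2 + t.2.1 * t.2.2 == M)%N) G t =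
  \sum_(t <- posbox4 M | odd_sol M t) G t.
Proof.
move=> G0; rewrite (bigID (fun t => [&& odd t.1.1, odd t.1.2, odd t.2.1 & odd t.2.2])) /=.
rewrite [X in _ + X]big1 ?addr0 => [|t /andP[_ /G0] //].
by apply: eq_bigl => t; rewrite /odd_sol andbC -!andbA.
Qed.

(* [liouville_even] with F(t) = cos (pi t / 2). *)
Lemma psi2_series_sqr : psi2_series ^+ 2 = sigma_series.
Proof.
apply: funext => n.
pose f a x := chi a * (odd x)%:Z.
(* By [lam_chi_odd] the square of [lam f] is q^2 Q(q^4)^2, read off at the exponent 4 n + 2. *)
have -> : (psi2_series ^+ 2) n = (lam f * lam f) (2 * (2 * n).+1)%N.
  rewrite lam_chi_odd mulrACA monoM -!rmorphM /= expr2 coef_monoM.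
  by rewrite mulnS /= subSS subSS subn0 !coef_dil2.
rewrite coef_lamM /f big_odd_sol => [|t]; last first.
  case: (boolP (odd t.1.1)) => [_|e1 _]; last by rewrite (chi_even e1) ?mul0r.
  case: (odd t.1.2) => /=; last by rewrite mulr0 mul0r.
  case: (boolP (odd t.2.1)) => [_|e1 _]; last by rewrite (chi_even e1) ?mul0r ?mulr0.
  by case: (odd t.2.2) => //=; rewrite mulr0 mulr0.
pose F t : int := if odd t then 0 else (-1) ^+ t./2.
have e := liouville_even (2 * n).+1 F.
rewrite /sigma_series (sigmaE (B := 2 * (2 * n).+1)); last by clear e; lia.
(* Both sides are doubled: F(a - b) - F(a + b) = 2 chi(a) chi(b) for odd a, b, and F(0) - F(2 d) = 2
   for odd d. *)
apply: (pmulrnI (isT : (0 < 2)%N)); rewrite /= -!sumrMnl.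
etransitivity; [|etransitivity; [exact: e|]].
  apply: eq_bigr => -[[a x] [b y]] /and5P[/= oa ox ob oy _].
  rewrite ox oy !mulr1 !chi_odd // /F.
  have -> : odd (a - b + (b - a)) = false by clear e; lia.
  have -> : odd (a + b) = false by clear e; lia.
  rewrite -exprD mulr2n -[X in _ - X]mul1r -mulNr -exprS.
  by congr (_ + _); apply: eq_sign; clear e; lia.
rewrite big_seq_cond [RHS]big_seq_cond; apply: eq_big => [[d x]|[d x]] /=.
  case: (boolP (_ \in _)) => //= _; case: eqP => //= dx.
  by have := oddM d x; rewrite dx /= oddM /= => /esym/andP[].
case/andP=> _ /andP[/eqP dx _].
have /andP[od _] : odd d && odd x by rewrite -oddM dx /= oddM.
have -> : F (2 * d)%N = -1 by rewrite /F oddM /= mul2n doubleK -signr_odd od.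
have -> : F 0%N = 1 by [].
by rewrite -mulr_natl natz mulr2n; lia.
Qed.

(* [liouville_even] with F(t) = t^2. *)
Lemma sigma_series_sqr n : (sigma_series ^+ 2) n = (sigma3_sharp n.+1)%:Z.
Proof.
pose f a x := a%:Z * (odd a && odd x)%:Z.
have -> : (sigma_series ^+ 2) n = (lam f * lam f) (2 * n.+1)%N.
  rewrite lam_id_odd mulrACA monoM -!rmorphM /= expr2 coef_monoM.
  by rewrite mulnS /= subSS subSS subn0 !coef_dil2.
rewrite coef_lamM /f big_odd_sol => [|t]; last first.
  case: (odd t.1.1); last by rewrite mulr0 mul0r.
  case: (odd t.1.2); last by rewrite mulr0 mul0r.
  by case: (odd t.2.1) => /=; [case: (odd t.2.2) => //= _|move=> _]; rewrite mulr0 mulr0.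
have e := liouville_even n.+1 (fun t => (t * t)%N%:Z).
have -> : (sigma3_sharp n.+1)%:Z =
    \sum_(p <- posbox2 (2 * n.+1) | (p.1 * p.2 == n.+1)%N && odd p.2) (p.1 ^ 3)%N%:Z.
  rewrite /sigma3_sharp (big_morph Posz PoszD (erefl _)) big_mkcond big_mkcondr.
  apply: (sum_divisors (fun d x => if odd x then (d ^ 3)%N%:Z else 0)).
  by clear e; lia.
(* (a - b)^2 - (a + b)^2 = -4 a b, and d (0 - (2 d)^2) = -4 d^3. *)
apply: (mulfI (x := -4)) => //.
rewrite /= !mulr_sumr; etransitivity; [|etransitivity; [exact: e|]].
  apply: eq_bigr => -[[a x] [b y]] /and5P[/= oa ox ob oy _].
  by rewrite oa ox ob oy /= !mulr1; clear e; have [ab|ab] := leqP a b; nia.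
apply: eq_bigr => p _; rewrite -mulr_natl natz; clear e.
by rewrite !expnS expn0; lia.
Qed.

(* [liouville_odd] with F = 1. *)
Lemma phi2_psi2_series : phi2_series * dil psi2_series = sigma_series.
Proof.
apply: funext => n.
pose f a x := chi x * (odd a)%:Z.
have fE : lam f = X * dil (dil psi2_series).
  by rewrite -lam_chi_odd; apply: funext => m; rewrite lam_swap.
have -> : (phi2_series * dil psi2_series) n = (lam f * dil phi2_series) (2 * n).+1.
  by rewrite fE -mulrA coef_XM -rmorphM /= coef_dil2 mulrC.
have om : odd (2 * n).+1 by lia.
have cE : chi_series = lam (fun _ y => chi y) by apply: funext => m; rewrite -lam_swap.
rewrite /phi2_series cE rmorphD rmorph1 rmorphMn /= mulrDr mulr1 mulrnAr.
rewrite coef_fpsD coef_fpsMn coef_lamM_dil (@lamE _ (2 * n).+1) //.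
have e := liouville_odd (fun=> 1) om.
rewrite /sigma_series (sigmaE (B := (2 * n).+1)) ?leqnn //.
(* The constant term of P contributes the sum of chi(x) over a x = 2 n + 1, which cancels the term -
   chi(x) of [liouville_odd]. *)
rewrite addrC; apply/esym/eqP; rewrite -subr_eq -sumrB; apply/eqP/esym.
etransitivity; [|etransitivity; [exact: e|]]; last first.
  rewrite big_seq_cond [RHS]big_seq_cond; apply: eq_bigr => -[d x] /= /andP[_ /eqP dx].
  by have := oddM d x; rewrite dx om => /esym/andP[od _]; rewrite /f od mulr1 mul1r.
rewrite /mixed_sol big_mkcondl -sumrMnl; apply: eq_bigr => -[[a x] [k y]] /= /eqP s.
rewrite /f; case: (boolP (odd y)) => [oy|/chi_even->]; last by rewrite mulr0 mul0rn.
have := oddM a x; have -> : (odd (a * x)) by clear e; lia.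
by move=> /esym/andP[-> _]; rewrite mulr1; ring.
Qed.

(* [liouville_odd] with F(t) = t chi(t). *)
Lemma phi2_sigma_series n : (phi2_series * sigma_series) (2 * n).+1 =
  - \sum_(d <- divisors (4 * n + 3)) (d ^ 2)%N%:Z * chi d.
Proof.
set M := (4 * n + 3)%N; have oM : odd M by rewrite /M; lia.
pose f a x := chi x * (chi a * a%:Z).
pose g k y := (-1) ^+ k * chi y.
(* This is P(-q), up to [dil] the series that carries the sign (-1)^k. *)
pose s : fps := fun v => (-1) ^+ v * phi2_series v.
have fE m : (0 < m)%N -> lam f m = chi m * (sigma m)%:Z.
  move=> m0; rewrite (@lamE _ m) // (@sigmaE m) ?m0 ?leqnn // mulr_sumr.
  by apply: eq_bigr => p /eqP <-; rewrite chiM /f; ring.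
have gE : 1 + lam g *+ 4 = s.
  apply: funext => v; rewrite /s /phi2_series !coef_fpsD !coef_fpsMn coef_fps1 mulrDr mulrnAr.
  congr (_ + _ *+ 4); first by case: v => //= v; rewrite mulr0.
  rewrite lam_swap /chi_series !(@lamE _ v) // mulr_sumr.
  apply: eq_bigr => -[y k] /= /eqP yk; rewrite /g.
  case: (boolP (odd y)) => [oy|/chi_even->]; last by rewrite !mulr0.
  by congr (_ * _); apply: eq_sign; rewrite -yk oddM oy.
have -> : (phi2_series * sigma_series) (2 * n).+1 = (X * dil sigma_series * dil phi2_series) M.
  have -> : M = (2 * (2 * n).+1).+1 by rewrite /M; lia.
  by rewrite -mulrA coef_XM -rmorphM /= coef_dil2 mulrC.
(* For i + 2 v = M, which is 3 mod 4, chi(i) = - (-1)^v; the twists by chi(i) and by (-1)^v thus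
   cancel up to a global minus sign. *)
have -> : (X * dil sigma_series * dil phi2_series) M = - (lam f * dil s) M.
  rewrite !coef_fpsM -sumrN; apply: eq_bigr => -[i /= iM] _.
  case: (boolP (odd i)) => oi; last first.
    case: i iM oi => [|i] iM oi; first by rewrite coef_XM0 /lam !mul0r oppr0.
    by rewrite coef_XM fE // chi_even // /dil ifT ?mul0r ?oppr0 //; lia.
  have [j ij] : exists j, i = (2 * j).+1 by exists i./2; lia.
  have [v Mv] : exists v, (M - i = 2 * v)%N by exists (M - i)./2; lia.
  have chii : chi i = - (-1) ^+ v.
    by rewrite chi_odd // -[RHS]mulN1r -exprS; apply: eq_sign; rewrite /M in Mv; lia.
  rewrite Mv fE ?ij // coef_XM !coef_dil2 /s -ij chii /sigma_series -ij.
  by rewrite !mulNr opprK mulrACA -exprD addnn -signr_odd odd_double mul1r.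
congr (- _). rewrite -gE rmorphD rmorph1 rmorphMn /= mulrDr mulr1 mulrnAr.
rewrite coef_fpsD coef_fpsMn coef_lamM_dil (@lamE _ M) //.
have e := liouville_odd (fun t => t%:Z * chi t) oM.
have M0 : (0 < M <= M)%N by rewrite leqnn /M; lia.
rewrite (sum_divisors (fun d _ => (d ^ 2)%N%:Z * chi d) M0).
rewrite addrC; apply/esym/eqP; rewrite -subr_eq -sumrB; apply/eqP/esym.
etransitivity; [|etransitivity; [exact: e|]]; last first.
  apply: eq_bigr => -[d x] /= _; rewrite /f expnS expn1 PoszM; ring.
rewrite /mixed_sol big_mkcondl -sumrMnl; apply: eq_bigr => -[[a x] [k y]] /= /eqP sl.
rewrite /f /g; case: (boolP (odd y)) => [oy|/chi_even->]; last by rewrite !mulr0 mul0rn.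
have := oddM a x; have -> : odd (a * x) by clear e; lia.
move=> /esym/andP[oa ox].
(* As t chi(t) is even, F(a + 2 k) + F(a - 2 k) = (-1)^k chi(a) ((a + 2 k) + (a - 2 k)) = 2 (-1)^k a
   chi(a). *)
have e1 : chi (a + 2 * k) = (-1) ^+ k * chi a.
  by rewrite !chi_odd -?exprD; [apply: eq_sign| |]; clear e; lia.
have e2 : (a - 2 * k + (2 * k - a))%N%:Z * chi (a - 2 * k + (2 * k - a))%N =
    (-1) ^+ k * chi a * (a%:Z - 2 * k%:Z).
  have [ak|ka] := leqP (2 * k) a.
    have -> : (a - 2 * k + (2 * k - a))%N = (a - 2 * k)%N by clear e; lia.
    have -> : (a - 2 * k)%N%:Z = a%:Z - 2 * k%:Z by clear e; lia.
    rewrite mulrC; congr (_ * _).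
    by rewrite !chi_odd -?exprD; [apply: eq_sign| |]; clear e; lia.
  have -> : (a - 2 * k + (2 * k - a))%N = (2 * k - a)%N by clear e; lia.
  have -> : (2 * k - a)%N%:Z = - (a%:Z - 2 * k%:Z) by clear e; lia.
  rewrite mulNr -mulrN mulrC; congr (_ * _).
  rewrite !chi_odd -?exprD; [|clear e; lia..].
  by rewrite -[LHS]mulN1r -exprS; apply: eq_sign; clear e; lia.
rewrite e1 e2; ring.
Qed.

(** * Sums of triangular numbers *)

Lemma sqr_series : phi ^+ 2 = phi2_series /\ psi ^+ 2 = psi2_series.
Proof.
apply: dissection_unique.
- by rewrite {1}[psi ^+ 2]psi_sqr exprMn rmorphXn.
- exact: phi_sqr.
- by rewrite psi2_series_sqr phi2_psi2_series.
- exact: phi2_series_split.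
- by rewrite expr2 coef_fpsM big_ord1 /phi2_series coef_fpsD coef_fpsMn.
- rewrite expr2 coef_fpsM big_ord1 /psi; have -> // : istri 0.
  by apply/istriP; exists 0%N.
- by rewrite /psi2_series /chi_series /lam big_seq1.
Qed.

Lemma psi4 : psi ^+ 4 = sigma_series.
Proof. by rewrite -[4%N]/(2 * 2)%N exprM (proj2 sqr_series) psi2_series_sqr. Qed.

Lemma psi8 n : (psi ^+ 8) n = (sigma3_sharp n.+1)%:Z.
Proof. by rewrite -[8%N]/(4 * 2)%N exprM psi4 sigma_series_sqr. Qed.

(* The odd part of phi^2 psi^4 = phi^4 psi(q^2)^2 is read off [phi_sqr]. *)
Lemma psi6 n : (psi ^+ 6) n * 8 = - \sum_(d <- divisors (4 * n + 3)) (d ^ 2)%N%:Z * chi d.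
Proof.
rewrite -phi2_sigma_series -psi4 -(proj1 sqr_series).
(* In the square of [phi_sqr] only the cross term has odd exponents; phi^2 psi(q^2)^2 = psi^4 turns
   it, times psi(q^2)^2, into 8 q psi(q^2)^6. *)
have -> : phi ^+ 2 * psi ^+ 4 = dil (phi ^+ 4 * psi ^+ 2 + X * dil (psi ^+ 2) ^+ 2 * psi ^+ 2 *+ 16)
    + X * dil (psi ^+ 6) *+ 8.
  have -> : psi ^+ 4 = phi ^+ 2 * dil (psi ^+ 2).
    rewrite (rmorphXn dil) -exprMn -psi_sqr; ring.
  have -> : phi ^+ 2 * (phi ^+ 2 * dil (psi ^+ 2)) = (phi ^+ 2) ^+ 2 * dil (psi ^+ 2) by ring.
  have -> : psi ^+ 6 = phi ^+ 2 * dil psi ^+ 2 * psi ^+ 2.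
    by rewrite -exprMn -psi_sqr; ring.
  rewrite {1}phi_sqr !(rmorphD, rmorphMn, rmorphM dil) /=.
  have -> : dil X = X ^+ 2 by rewrite dil_mono expr2 monoM.
  ring.
rewrite coef_fpsD coef_dil2S add0r coef_fpsMn coef_XM coef_dil2.
exact: mulr_natr.
Qed.

(** * Evaluation of the coefficients *)

(** Two squares with sum 2 mod 4 are both odd, each of the form 8 T + 1 with two signs, whence the
    factor 2^2. *)
Lemma coef_phi2_mod8 b : (phi ^+ 2) (8 * b + 2)%N = (psi ^+ 2) b * 4.
Proof.
have -> : phi ^+ 2 = dil (dil (phi ^+ 2)) + X * dil (dil (phi * dil psi)) *+ 4 +
   X * (X * dil (dil (dil (psi ^+ 2)))) *+ 4.
  by rewrite {1}phi_split !(rmorphM dil) /=; ring.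
have -> : (8 * b + 2 = (2 * (2 * (2 * b))).+2)%N by lia.
rewrite !coef_fpsD !coef_fpsMn !coef_XM !coef_dil2 coef_dil2S.
have -> : (2 * (2 * (2 * b))).+2 = (2 * (2 * (2 * b)).+1)%N by lia.
by rewrite coef_dil2 coef_dil2S mul0rn !add0r mulr_natr.
Qed.

(** Three squares with sum 3 mod 4 are all odd, whence 2^3. *)
Lemma coef_phi3_mod8 b : (phi ^+ 3) (8 * b + 3)%N = (psi ^+ 3) b * 8.
Proof.
have -> : phi ^+ 3 = dil (dil (phi ^+ 3)) + X * dil (dil (phi ^+ 2 * dil psi)) *+ 6 +
   X * (X * dil (dil (phi * dil psi ^+ 2))) *+ 12 +
   X * (X * (X * dil (dil (dil (psi ^+ 3))))) *+ 8.
  by rewrite {1}phi_split !(rmorphM dil) /=; ring.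
have -> : (8 * b + 3 = (2 * (2 * (2 * b))).+3)%N by lia.
rewrite !coef_fpsD !coef_fpsMn !coef_XM !coef_dil2 coef_dil2S.
have -> : (2 * (2 * (2 * b))).+3 = (2 * (2 * (2 * b)).+1).+1%N by lia.
have -> : (2 * (2 * (2 * b))).+2 = (2 * (2 * (2 * b)).+1)%N by lia.
by rewrite coef_dil2S coef_dil2 coef_dil2S !mul0rn !add0r mulr_natr.
Qed.

Lemma delta_double k n : (delta_ (2 * k) n)%:Z =
  \sum_(p : 'I_n.+1 * 'I_n.+1 | (p.1 + 2 * p.2 == n)%N) (r_ k p.1)%:Z * (psi ^+ k) p.2.
Proof.
rewrite delta_psi exprM expr2 psi_sqr exprMn -rmorphXn /= coef_fpsM.
rewrite [RHS]big_mkcond; etransitivity; last exact: (pair_bigA _ (fun i j : 'I_n.+1 =>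
  if (i + 2 * j == n)%N then (r_ k i)%:Z * (psi ^+ k) j else 0)).
apply: eq_bigr => i _; have il := ltn_ord i; case: (boolP (odd (n - i))) => o.
  by rewrite big1 /dil ?o ?mulr0 // => j _; rewrite ifF //; lia.
have jn : ((n - i)./2 < n.+1)%N by lia.
rewrite (bigD1 (Ordinal jn)) //= big1 => [|j ne].
  by rewrite ifT ?addr0 ?r_phi /dil ?(negbTE o) //; lia.
rewrite ifF //; apply: contraNF ne => /eqP e; apply/eqP/val_inj => /=.
by lia.
Qed.

Lemma natr_int (R : pzRingType) (m : nat) : m%:R = m%:Z%:~R :> R.
Proof. by rewrite pmulrn. Qed.

(* A pair with a + 2 b = n has a, b <= n, so it is indexed by 'I_n.+1 * 'I_n.+1. *)
Theorem corollary1p8 (n : nat) :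
  [/\ (delta_ 4 n)%:R = 1 / 4 *
        \sum_(p : 'I_n.+1 * 'I_n.+1 | (p.1 + 2 * p.2 == n)%N)
          (r_ 2 p.1)%:R * (r_ 2 (8 * p.2 + 2))%:R :> rat,
      (delta_ 6 n)%:R = 1 / 8 *
        \sum_(p : 'I_n.+1 * 'I_n.+1 | (p.1 + 2 * p.2 == n)%N)
          (r_ 3 p.1)%:R * (r_ 3 (8 * p.2 + 3))%:R :> rat,
      (delta_ 8 n)%:R =
        \sum_(p : 'I_n.+1 * 'I_n.+1 | (p.1 + 2 * p.2 == n)%N)
          (r_ 4 p.1)%:R * (sigma (2 * p.2 + 1))%:R :> rat,
      (delta_ 12 n)%:R = - (1 / 8) *
        \sum_(p : 'I_n.+1 * 'I_n.+1 | (p.1 + 2 * p.2 == n)%N)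
          (r_ 6 p.1)%:R *
          sigma_chi 2 (chi_one rat) (chi_m4 rat) (4 * p.2 + 3) :> rat
    & (delta_ 16 n)%:R =
        \sum_(p : 'I_n.+1 * 'I_n.+1 | (p.1 + 2 * p.2 == n)%N)
          (r_ 8 p.1)%:R * (sigma3_sharp (p.2 + 1))%:R :> rat].
Proof.
have dE k : (delta_ (2 * k) n)%:R =
    \sum_(p : 'I_n.+1 * 'I_n.+1 | (p.1 + 2 * p.2 == n)%N)
      (r_ k p.1)%:R * ((psi ^+ k) p.2)%:~R :> rat.
  rewrite natr_int delta_double rmorph_sum; apply: eq_bigr => p _.
  by rewrite rmorphM /= -natr_int.
split.
- rewrite (dE 2%N) mulr_sumr; apply: eq_bigr => p _.
  by rewrite [in RHS](natr_int _ (r_ 2 (8 * p.2 + 2))) r_phi coef_phi2_mod8 rmorphM /=; field.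
- rewrite (dE 3%N) mulr_sumr; apply: eq_bigr => p _.
  by rewrite [in RHS](natr_int _ (r_ 3 (8 * p.2 + 3))) r_phi coef_phi3_mod8 rmorphM /=; field.
- rewrite (dE 4%N); apply: eq_bigr => p _.
  by rewrite psi4 /sigma_series addn1 -natr_int.
- rewrite (dE 6%N) mulr_sumr; apply: eq_bigr => p _.
  (* By [psi6] this divisor sum is -8 times the coefficient of psi^6, which accounts for the factor
     -1/8. *)
  have -> : sigma_chi 2 (chi_one rat) (chi_m4 rat) (4 * p.2 + 3) = - ((psi ^+ 6) p.2 * 8)%:~R.
    rewrite psi6 rmorphN opprK rmorph_sum; apply: eq_bigr => d _.
    rewrite rmorphM /= /chi_one mulr1 mulrC -natr_int natrX; congr (_ * _).
    by rewrite /chi_m4; do 2!case: ifP => _ //.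
  by rewrite rmorphM /=; field.
- rewrite (dE 8%N); apply: eq_bigr => p _.
  by rewrite psi8 addn1 -natr_int.
Qed.
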